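(* Any $\alpha\in\mathrm{Aut}_{\mathcal{D}_2}(\mathcal{Q}_2)$ restricts to an automorphism of the Cuntz algebra $\mathcal{O}_2\subset\mathcal{Q}_2$ fixing the diagonal $\mathcal{D}_2$ pointwise, and $\alpha$ is the unique extension of this restriction to an automorphism of $\mathcal{Q}_2$. In particular, the group $\mathrm{Aut}_{\mathcal{D}_2}(\mathcal{Q}_2)$ is abelian.
   Context: $\mathcal{Q}_2$ (the 2-adic ring $C^*$-algebra) is the universal unital $C^*$-algebra generated by an isometry $S_2$ and a unitary $U$ such that $S_2S_2^*+US_2S_2^*U^*=1$ and $S_2U=U^2S_2$. Put $S_1=US_2$. The $C^*$-subalgebra generated by $S_1,S_2$ is a copy of the Cuntz algebra $\mathcal{O}_2$, and $\mathcal{O}_2\subset\mathcal{Q}_2$ always refers to this copy. For a multi-index $\alpha=(\alpha_1,\ldots,\alpha_k)\in\{1,2\}^k$ let $S_\alpha=S_{\alpha_1}\cdots S_{\alpha_k}$ and $P_\alpha=S_\alpha S_\alpha^*$; the diagonal subalgebra $\mathcal{D}_2\subset\mathcal{O}_2$ is the (commutative) $C^*$-algebra generated by all projections $P_\alpha$. $\mathrm{Aut}_{\mathcal{D}_2}(\mathcal{Q}_2)$ is the group of unital $*$-automorphisms of $\mathcal{Q}_2$ fixing every element of $\mathcal{D}_2$. *)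

(* Defs.v *)
From HB Require Import structures.
From mathcomp Require Import all_boot all_order all_algebra.
From mathcomp Require Import complex.
From mathcomp Require Import all_classical all_reals all_analysis.

Set Implicit Arguments.
Unset Strict Implicit.
Unset Printing Implicit Defensive.

Import Order.TTheory GRing.Theory Num.Theory.
Import numFieldNormedType.Exports.
Import ComplexField.Normc.

Local Open Scope classical_set_scope.
Local Open Scope complex_scope.
Local Open Scope ring_scope.

(* Unital C*-algebras over R[i].  Hierarchy-Builder does not accept a structure
   joining GRing.Algebra and CompleteNormedModule (GRing.PzSemiRing and
   Num.SemiNormedZmodule only have the join Num.NumDomain), so the complete norm
   is part of the mixin; it is real-valued.  Since algType is built on
   nontrivial rings, the zero algebra is excluded. *)
HB.mixin Record isCStarAlgebra (R : realType) A of GRing.Algebra R[i] A := {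
  cnorm : A -> R;
  star : A -> A;
  cnormD : forall x y : A, cnorm (x + y) <= cnorm x + cnorm y;
  cnormZ : forall (a : R[i]) (x : A), cnorm (a *: x) = normc a * cnorm x;
  cnorm_eq0 : forall x : A, cnorm x = 0 -> x = 0;
  cnormM : forall x y : A, cnorm (x * y) <= cnorm x * cnorm y;
  cnorm_complete : forall u : nat -> A,
    (forall e : R, 0 < e -> exists N : nat, forall m n : nat,
       (N <= m)%N -> (N <= n)%N -> cnorm (u m - u n) < e) ->
    exists l : A, cnorm (u n - l) @[n --> \oo] --> (0 : R);
  starD : forall x y : A, star (x + y) = star x + star y;
  starZ : forall (a : R[i]) (x : A), star (a *: x) = conjc a *: star x;
  starM : forall x y : A, star (x * y) = star y * star x;
  starK : forall x : A, star (star x) = x;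
  cstar_id : forall x : A, cnorm (star x * x) = cnorm x ^+ 2
}.

#[short(type="cstarType")]
HB.structure Definition CStarAlgebra (R : realType) :=
  {A of GRing.Algebra R[i] A & isCStarAlgebra R A}.

Section CStar.
Variable R : realType.
Implicit Types A B : cstarType R.

Definition cnorm_closed A (D : set A) : Prop :=
  forall (u : nat -> A) (l : A), (forall n, D (u n)) ->
    cnorm (u n - l) @[n --> \oo] --> (0 : R) -> D l.

Definition cstar_subalgebra A (D : set A) : Prop :=
  [/\ cnorm_closed D,
      D 0 /\ (forall x y, D x -> D y -> D (x + y)),
      forall (a : R[i]) x, D x -> D (a *: x),
      forall x y, D x -> D y -> D (x * y) &
      forall x, D x -> D (star x)].

Definition cstar_gen A (X : set A) : set A :=
  [set x | forall D : set A, cstar_subalgebra D -> X `<=` D -> D x].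

(* [f], restricted to the unital subalgebra [D], is a unital
   *-homomorphism *)
Definition star_hom_on A B (D : set A) (f : A -> B) : Prop :=
  [/\ forall x y, D x -> D y -> f (x + y) = f x + f y,
      forall (a : R[i]) x, D x -> f (a *: x) = a *: f x,
      forall x y, D x -> D y -> f (x * y) = f x * f y,
      f 1 = 1 &
      forall x, D x -> f (star x) = star (f x)].

Definition star_aut_on A (D : set A) (f : A -> A) : Prop :=
  star_hom_on D f /\ set_bij D D f.

Definition isometry_elt A (s : A) : Prop := star s * s = 1.

Definition unitary_elt A (u : A) : Prop :=
  star u * u = 1 /\ u * star u = 1.

Definition Q2_relations A (S2 U : A) : Prop :=
  [/\ isometry_elt S2, unitary_elt U,
      S2 * star S2 + U * S2 * star S2 * star U = 1 &
      S2 * U = U ^+ 2 * S2].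

(* [A] is the universal unital C*-algebra generated by [S2] and [U] subject to
   [Q2_relations]; the *-homomorphism [f] is unique because [S2] and [U]
   generate [A]. *)
Definition is_Q2 A (S2 U : A) : Prop :=
  [/\ Q2_relations S2 U,
      cstar_gen [set S2; U] = setT &
      forall (B : cstarType R) (T V : B), Q2_relations T V ->
        exists f : A -> B, [/\ star_hom_on setT f, f S2 = T & f U = V]].

(* Letters of multi-indices: [true] stands for 1 and [false] for 2. *)
Definition cuntz_gen A (S2 U : A) (i : bool) : A := if i then U * S2 else S2.

Definition cuntz_word A (S2 U : A) (w : seq bool) : A :=
  \prod_(i <- w) cuntz_gen S2 U i.

Definition cuntz_proj A (S2 U : A) (w : seq bool) : A :=
  cuntz_word S2 U w * star (cuntz_word S2 U w).

Definition O2 A (S2 U : A) : set A := cstar_gen (range (cuntz_gen S2 U)).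

Definition D2 A (S2 U : A) : set A := cstar_gen (range (cuntz_proj S2 U)).

Definition Aut_fixing A (D : set A) : set (A -> A) :=
  [set f | star_aut_on setT f /\ forall x, D x -> f x = x].

End CStar.

(* Main.v *)
(* Put [aff a m = U ^ a * S2 ^ m]; on [l^2(Z)] it is the affine map
   [k |-> 2 ^ m * k + a].  The elements [aff a m * star (aff b n)] span a dense
   *-subalgebra, and [D2] is maximal abelian for the following reason.  Compress
   [x] in the commutant of [D2], and an approximant [y] of [x] in that span, by
   a long word [S_w].  Each term of [y] becomes [0] or a power of one isometry
   [s] or of [star s]: affine maps that do not move a small ball off itself have
   a common fixed point.  With [T = U * s] and [W] the normalised sum of the
   [L] isometries [s ^ j * T * s ^ (L - j)], the map [star W * _ * W] almost
   fixes polynomials in [s] and [star s], and maps [x] close to a scalar because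
   [x] commutes with [D2].  So [x] is locally almost scalar, hence lies in [D2].

   If [alpha] fixes [D2] and [v] is one of [S2], [U * S2], [U], then
   [star v * alpha v] commutes with [D2], so that [alpha v = v * d] with [d] in
   [D2].  This gives the restriction to [O2] and the commutation of any two such
   automorphisms.  An automorphism fixing [O2] sends [U] to [U * d] with
   [d - 1] supported on the range of every [(U * S2) ^ N], hence [d = 1]. *)

Require Import Defs.
From mathcomp Require Import all_boot all_order all_algebra.
From mathcomp Require Import complex zify ring lra.
From mathcomp Require Import all_classical all_reals all_analysis.

Set Implicit Arguments.
Unset Strict Implicit.
Unset Printing Implicit Defensive.

Import Order.TTheory GRing.Theory Num.Theory.
Import numFieldNormedType.Exports.
Import ComplexField.Normc.

Local Open Scope classical_set_scope.
Local Open Scope ring_scope.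

(** * Norm and involution: consequences of the C*-identity, and closedness in epsilon form *)

Section CStarBasics.
Variable R : realType.
Implicit Types A B : cstarType R.

Lemma normcR (r : R) : normc (r%:C)%C = `|r|.
Proof. by rewrite /= expr0n addr0 sqrtr_sqr. Qed.

Lemma conjcR (r : R) : conjc (r%:C)%C = (r%:C)%C.
Proof. by rewrite /= oppr0. Qed.

Lemma star0 A : star (0 : A) = 0.
Proof. by rewrite -[0 in LHS](scale0r (0 : A)) starZ conjcR scale0r. Qed.

Lemma starN A (x : A) : star (- x) = - star x.
Proof. by apply/eqP; rewrite -subr_eq0 opprK -starD addNr star0. Qed.

Lemma starB A (x y : A) : star (x - y) = star x - star y.
Proof. by rewrite starD starN. Qed.

Lemma star1 A : star (1 : A) = 1.
Proof. by rewrite -[LHS]mulr1 -[X in _ * X]starK -starM mulr1 starK. Qed.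

Lemma star_sum A (I : Type) (r : seq I) (P : pred I) (F : I -> A) :
  star (\sum_(i <- r | P i) F i) = \sum_(i <- r | P i) star (F i).
Proof. by apply: (big_morph _ (@starD R A) (@star0 A)). Qed.

Lemma starX A (x : A) n : star (x ^+ n) = star x ^+ n.
Proof. by elim: n => [|n IH]; rewrite ?star1 // exprS starM IH -exprSr. Qed.

Lemma cnorm0 A : cnorm (0 : A) = 0.
Proof. by rewrite -(scale0r (0 : A)) cnormZ normcR normr0 mul0r. Qed.

Lemma cnormZr A (r : R) (x : A) : cnorm ((r%:C)%C *: x) = `|r| * cnorm x.
Proof. by rewrite cnormZ normcR. Qed.

Lemma cnormN A (x : A) : cnorm (- x) = cnorm x.
Proof.
by rewrite -scaleN1r (_ : -1 = ((-1)%:C)%C) ?cnormZr ?normrN ?normr1 ?mul1r// rmorphN.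
Qed.

Lemma cnorm_ge0 A (x : A) : 0 <= cnorm x.
Proof. have := cnormD x (- x); rewrite subrr cnorm0 cnormN; lra. Qed.

Lemma cnorm_distC A (x y : A) : cnorm (x - y) = cnorm (y - x).
Proof. by rewrite -opprB cnormN. Qed.

(** The C*-identity gives [cnorm y ^ 2 <= cnorm (star y) * cnorm y]; cancelling [cnorm y] and
    exchanging [y] with [star y] yields both inequalities. *)
Lemma cnorm_star A (x : A) : cnorm (star x) = cnorm x.
Proof.
suff H y : cnorm y <= cnorm (star y :> A).
  by apply/eqP; rewrite eq_le H andbT -{2}(starK x) H.
have := cnorm_ge0 y; rewrite le_eqVlt => /predU1P[<-|y0]; first exact: cnorm_ge0.
by rewrite -(ler_pM2r y0) -expr2 -cstar_id cnormM.
Qed.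

Lemma cnorm_eq0P A (x : A) : star x * x = 0 -> x = 0.
Proof.
move=> h; apply: cnorm_eq0; have := cstar_id x; rewrite h cnorm0 => /esym/eqP.
by rewrite expf_eq0 /= => /eqP.
Qed.

Lemma cnorm1 A : cnorm (1 : A) = 1.
Proof.
have := cstar_id (1 : A); rewrite star1 mulr1 => /eqP.
rewrite -subr_eq0 expr2 -{1}(mulr1 (cnorm 1)) -mulrBr mulf_eq0 subr_eq0.
by case/orP=> /eqP // /cnorm_eq0 /eqP; rewrite oner_eq0.
Qed.

Lemma cnorm_isometry A (s : A) : isometry_elt s -> cnorm s = 1.
Proof.
move=> h; have := cstar_id s; rewrite h cnorm1 => /esym/eqP.
by rewrite sqrf_eq1 => /orP[/eqP//|/eqP h1]; have := cnorm_ge0 s; lra.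
Qed.

Lemma cnorm_sum A (I : Type) (r : seq I) (P : pred I) (F : I -> A) :
  cnorm (\sum_(i <- r | P i) F i) <= \sum_(i <- r | P i) cnorm (F i).
Proof.
elim/big_rec2: _ => [|i y x _ h]; first by rewrite cnorm0.
by apply: le_trans (cnormD _ _) _; rewrite lerD2l.
Qed.

Lemma cnorm_dist_trans A (y x z : A) :
  cnorm (x - z) <= cnorm (x - y) + cnorm (y - z).
Proof. by rewrite -[x - z](subrKA y) cnormD. Qed.

Lemma cnorm_le0 A (x : A) : (forall e : R, 0 < e -> cnorm x <= e) -> x = 0.
Proof.
move=> h; apply: cnorm_eq0; apply/eqP; rewrite eq_le cnorm_ge0 andbT.
by apply/ler_addgt0Pl => e /h; rewrite addr0.
Qed.

Lemma cnormM_le A (x y : A) (a b : R) :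
  cnorm x <= a -> cnorm y <= b -> cnorm (x * y) <= a * b.
Proof.
by move=> h1 h2; apply: le_trans (cnormM _ _) _; apply: ler_pM => //; exact: cnorm_ge0.
Qed.

Lemma cvg_cnormP A (u : nat -> A) (l : A) :
  cnorm (u n - l) @[n --> \oo] --> (0 : R) <->
  (forall e : R, 0 < e -> exists N : nat, forall n : nat,
     (N <= n)%N -> cnorm (u n - l) < e).
Proof.
split.
- move=> /cvgr0Pnorm_lt h e e0; have [N _ hN] := h _ e0.
  exists N => n Nn; have := hN n Nn; rewrite /= ger0_norm //; exact: cnorm_ge0.
- move=> h; apply/cvgr0Pnorm_lt => e e0; have [N hN] := h _ e0.
  exists N => // n /= Nn; rewrite ger0_norm ?hN //; exact: cnorm_ge0.
Qed.

(** Later closedness proofs use this form, which works with single approximants in place of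
    sequences. *)
Lemma cnorm_closed_approx A (D : set A) :
  cnorm_closed D <->
  (forall x, (forall e : R, 0 < e -> exists2 y, D y & cnorm (x - y) <= e) -> D x).
Proof.
split=> h.
- move=> x hx.
  have /choice[u hu] n : exists y, D y /\ cnorm (x - y) <= n.+1%:R^-1.
    by have [|y ? ?] := hx n.+1%:R^-1; [rewrite invr_gt0|exists y].
  apply: (h u) => [n|]; first by have [] := hu n.
  apply/cvg_cnormP => e e0.
  have [N hN] : exists N : nat, N.+1%:R^-1 < e.
    exists (Num.truncn e^-1); rewrite invf_plt ?posrE//.
    exact: truncnS_gt.
  exists N => n Nn; rewrite cnorm_distC; apply: le_lt_trans (proj2 (hu n)) _.
  by apply: le_lt_trans hN; rewrite lef_pV2 ?posrE// ler_nat ltnS.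
- move=> u l Du /cvg_cnormP hl; apply: h => e e0; have [N hN] := hl _ e0.
  by exists (u N) => //; rewrite cnorm_distC ltW// hN.
Qed.

End CStarBasics.

(** * Contractivity of unital *-homomorphisms, without spectral theory *)

Section Contractivity.
Variable R : realType.
Implicit Types A B : cstarType R.

(* [sqrt (1 - h ^ 2) = 1 - c], where [c] is the fixed point of the contraction
   [c |-> (h ^ 2 + c ^ 2) / 2]. *)
Lemma sqrt_one_sub_sq A (h : A) : star h = h -> cnorm h < 1 ->
  exists b : A, [/\ star b = b, h * b = b * h & h ^+ 2 + b ^+ 2 = 1].
Proof.
move=> hs h1; set t := cnorm h in h1; have t0 : 0 <= t := cnorm_ge0 h.
pose half : R[i] := (2^-1%:C)%C.
have half2 (x : A) : half *: x + half *: x = x.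
  have h2 : 2^-1 + 2^-1 = 1 :> R by field.
  by rewrite -scalerDl -rmorphD h2 scale1r.
pose G (c : A) := half *: (h ^+ 2 + c ^+ 2).
pose u n := iter n G 0.
have uS n : u n.+1 = G (u n) by [].
have cn2 (x : A) r : cnorm x <= r -> cnorm (x ^+ 2) <= r * r.
  by move=> ?; rewrite expr2; exact: cnormM_le.
have cnhalf (x : A) : cnorm (half *: x) = 2^-1 * cnorm x.
  by rewrite cnormZr ger0_norm// invr_ge0.
(* The ball of radius [t] is stable because [(t ^ 2 + t ^ 2) / 2 <= t] for [t < 1]. *)
have ub n : cnorm (u n) <= t.
  elim: n => [|n IH]; first by rewrite cnorm0.
  rewrite uS cnhalf; have := cnormD (h ^+ 2) (u n ^+ 2).
  have := cn2 h t (lexx _); have := cn2 _ _ IH; nra.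
have Glip (x y : A) : cnorm x <= t -> cnorm y <= t ->
    cnorm (G x - G y) <= t * cnorm (x - y).
  move=> hx hy; rewrite -scalerBr cnhalf opprD addrACA subrr add0r.
  (* This splitting holds without commutation, and makes [G] Lipschitz with constant [t] on the ball
     of radius [t]. *)
  have -> : x ^+ 2 - y ^+ 2 = x * (x - y) + (x - y) * y.
    by rewrite mulrBr mulrBl addrA subrK !expr2.
  have := cnormD (x * (x - y)) ((x - y) * y).
  have := cnormM_le hx (lexx (cnorm (x - y))).
  have := cnormM_le (lexx (cnorm (x - y))) hy; lra.
have step n : cnorm (u n.+1 - u n) <= t ^+ n.
  elim: n => [|n IH].
    by rewrite subr0; apply: le_trans (ub _) _; rewrite expr0 ltW.
  rewrite [X in X - _]uS [X in _ - X]uS exprS.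
  by apply: le_trans (Glip _ _ (ub _) (ub _)) _; rewrite ler_wpM2l.
have dist n k : cnorm (u (n + k)%N - u n) <= t ^+ n / (1 - t).
  (* The geometric sum is kept exact so that the induction on [k] closes; its negative term is
     dropped afterwards. *)
  have : cnorm (u (n + k)%N - u n) <= (t ^+ n - t ^+ (n + k)) / (1 - t).
    elim: k => [|k IH]; first by rewrite addn0 !subrr cnorm0 mul0r.
    apply: le_trans (cnorm_dist_trans (u (n + k)%N) _ _) _; rewrite addnS.
    apply: le_trans (lerD (step _) IH) _.
    rewrite ler_pdivlMr ?subr_gt0// mulrDl divfK ?subr_eq0 ?gt_eqF// exprS; lra.
  move=> /le_trans; apply; rewrite ler_pM2r ?invr_gt0 ?subr_gt0//.
  by rewrite gerBl exprn_ge0.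
have tcvg e : 0 < e -> exists N, forall n, (N <= n)%N -> t ^+ n / (1 - t) < e.
  move=> e0.
  have /cvgr0Pnorm_lt/(_ (e * (1 - t))) : t ^+ n @[n --> \oo] --> (0 : R).
    by apply: cvg_expr; rewrite ger0_norm.
  case; first by rewrite mulr_gt0// subr_gt0.
  move=> N _ hN; exists N => n Nn; rewrite ltr_pdivrMr ?subr_gt0//.
  by have := hN n Nn; rewrite /= ger0_norm// exprn_ge0.
have [|c /cvg_cnormP hc] := cnorm_complete u.
  move=> e e0; have [|N hN] := tcvg (e / 2); first by rewrite divr_gt0.
  exists N => m n Nm Nn.
  have := cnorm_dist_trans (u N) (u m) (u n); rewrite (cnorm_distC (u N)).
  have := dist N (m - N)%N; have := dist N (n - N)%N; rewrite !subnKC//.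
  have := hN _ (leqnn N); lra.
have near e : 0 < e -> exists n, cnorm (c - u n) < e /\ cnorm (c - u n.+1) < e.
  move=> /hc[N hN]; exists N; rewrite !(cnorm_distC c).
  by split; apply: hN.
have ct : cnorm c <= t.
  apply/ler_addgt0Pl => e /near[n [h2 _]].
  have := cnormD (c - u n) (u n); rewrite subrK; have := ub n; lra.
have us n : star (u n) = u n.
  elim: n => [|n IH]; first exact: star0.
  by rewrite uS /G starZ conjcR starD !starX IH hs.
have uh n : h * u n = u n * h.
  elim: n => [|n IH]; first by rewrite mulr0 mul0r.
  rewrite uS /G -scalerAl -scalerAr; congr (_ *: _).
  by rewrite mulrDl mulrDr -exprS -exprSr !expr2 mulrA IH -mulrA IH mulrA.
have cs : star c = c.
  apply/eqP; rewrite -subr_eq0; apply/eqP/cnorm_le0 => e e0.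
  have [|n [h2 _]] := near (e / 2); first by rewrite divr_gt0.
  apply: le_trans (cnorm_dist_trans (u n) _ _) _.
  rewrite -[X in cnorm (_ - X) + _]us -starB cnorm_star (cnorm_distC (u n)); lra.
have ch : h * c = c * h.
  apply/eqP; rewrite -subr_eq0; apply/eqP/cnorm_le0 => e e0.
  have [|n [h2 _]] := near (e / 2); first by rewrite divr_gt0.
  apply: le_trans (cnorm_dist_trans (h * u n) _ _) _.
  rewrite [X in _ + cnorm (X - _)]uh -mulrBr -mulrBl.
  have := cnormM_le (lexx t) (ltW h2); have := cnormM_le (ltW h2) (lexx t).
  have := cnormM h (c - u n); have := cnormM (u n - c) h.
  rewrite (cnorm_distC (u n)) -/t; have := cnorm_ge0 (c - u n); nra.
have cG : c = G c.
  apply/eqP; rewrite -subr_eq0; apply/eqP/cnorm_le0 => e e0.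
  have [|n [h2 h3]] := near (e / 2); first by rewrite divr_gt0.
  apply: le_trans (cnorm_dist_trans (u n.+1) _ _) _.
  rewrite uS in h3 *; have := Glip _ _ (ub n) ct.
  rewrite (cnorm_distC (u n)); have := cnorm_ge0 (c - u n); nra.
exists (1 - c); split.
- by rewrite starB star1 cs.
- by rewrite mulrBr mulrBl mulr1 mul1r ch.
- have h2 : c + c = h ^+ 2 + c ^+ 2 by rewrite {1 2}cG half2.
  rewrite (expr2 (1 - c)) mulrBl mul1r mulrBr mulr1 opprB -expr2.
  rewrite [1 - c + _]addrACA -opprD h2.
  move: (h ^+ 2) (c ^+ 2) => x y.
  by rewrite opprD (addrC (- x)) [1 + y + _]addrA addrK addrCA subrr addr0.
Qed.

(** For self-adjoint [h] of norm below 1 choose [b] with [h ^ 2 + b ^ 2 = 1]: then [f h] is the real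
    part of the isometry [f h + i * f b], so its norm is at most 1. Scaling handles all self-adjoint
    elements, and the C*-identity all of [A]. *)
Lemma star_hom_contractive A B (f : A -> B) : star_hom_on setT f ->
  forall x, cnorm (f x) <= cnorm x.
Proof.
case=> fD fZ fM f1 fs.
have small (h : A) : star h = h -> cnorm h < 1 -> cnorm (f h) <= 1.
  move=> hs h1; have [b [bs hb hb1]] := sqrt_one_sub_sq hs h1.
  have fhs : star (f h) = f h by rewrite -fs// hs.
  have fbs : star (f b) = f b by rewrite -fs// bs.
  have fc : f h * f b = f b * f h by rewrite -!fM// hb.
  pose u : B := f h + 'i%C *: f b.
  have su : star u = f h - 'i%C *: f b.
    rewrite starD starZ fhs fbs -scaleNr; congr (_ + _ *: _).
    by apply/eqP; rewrite eq_complex /= oppr0 !eqxx.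
  have uu : star u * u = 1.
    rewrite su mulrBl !mulrDr -!scalerAl -!scalerAr fc scalerA.
    rewrite (_ : 'i%C * 'i%C = -1); last first.
      by apply/eqP; rewrite eq_complex /= !mul0r !mulr0 mul1r sub0r addr0 oppr0 !eqxx.
    rewrite scaleN1r opprD opprK addrA addrK.
    by rewrite -f1 -hb1 fD// !expr2 !fM.
  have nu := cnorm_isometry uu.
  have : u + star u = ((2 : R)%:C)%C *: f h.
    by rewrite su addrACA subrr addr0 -mulr2n -scaler_nat rmorph_nat.
  move/(congr1 (@cnorm R B)); rewrite cnormZr ger0_norm//.
  have := cnormD u (star u); rewrite cnorm_star nu; lra.
have sa (h : A) : star h = h -> cnorm (f h) <= cnorm h.
  move=> hs; rewrite leNgt; apply/negP => lt; have := cnorm_ge0 h => h0.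
  (* A midpoint: [h / r] has norm below 1 while [f h / r] has norm above 1. *)
  set r := (cnorm h + cnorm (f h)) / 2.
  have r0 : 0 < r by rewrite /r; lra.
  have := small ((r^-1%:C)%C *: h).
  rewrite starZ conjcR hs fZ// !cnormZr gtr0_norm ?invr_gt0//.
  rewrite !(mulrC r^-1) ltr_pdivrMr// ler_pdivrMr// !mul1r /r => /(_ erefl).
  lra.
move=> x; rewrite -(ler_pXn2r (n := 2))// ?nnegrE ?cnorm_ge0//.
by rewrite -!cstar_id -fs// -fM// sa// starM starK.
Qed.

End Contractivity.

(** * C*-subalgebras and automorphisms; norm of a sum with orthogonal ranges *)

Section Subalgebras.
Variable R : realType.
Implicit Types A B : cstarType R.

Lemma cnorm_closed_preimage A B (f : A -> B) (D : set B) :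
  (forall x y, cnorm (f x - f y) <= cnorm (x - y)) ->
  cnorm_closed D -> cnorm_closed (f @^-1` D).
Proof.
move=> fle /cnorm_closed_approx hD. apply/cnorm_closed_approx => x hx.
apply: hD => e /hx[y Dy le]; exists (f y) => //; exact: le_trans (fle _ _) le.
Qed.

Lemma cstar_gen_subalgebra A (X : set A) : cstar_subalgebra (cstar_gen X).
Proof.
split.
- move=> u l hu ul D hD XD; have [hc _ _ _ _] := hD.
  by apply: hc ul => n; apply: hu.
- split=> [D [_ [] //]|x y hx hy D hD XD]; have [_ [_ h] _ _ _] := hD.
  by apply: h; [apply: hx|apply: hy].
- by move=> a x hx D hD XD; have [_ _ h _ _] := hD; apply: h; apply: hx.
- by move=> x y hx hy D hD XD; have [_ _ _ h _] := hD; apply: h; [apply: hx|apply: hy].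
- by move=> x hx D hD XD; have [_ _ _ _ h] := hD; apply: h; apply: hx.
Qed.

Lemma sub_cstar_gen A (X : set A) : X `<=` cstar_gen X.
Proof. by move=> x Xx D _; apply. Qed.

Lemma star_hom_dist A B (f : A -> B) : star_hom_on setT f ->
  forall x y, cnorm (f x - f y) <= cnorm (x - y).
Proof.
move=> hf x y; have [fD fZ _ _ _] := hf.
by rewrite -scaleN1r -fZ// -fD// scaleN1r; exact: star_hom_contractive.
Qed.

Lemma star_hom0 A B (f : A -> B) : star_hom_on setT f -> f 0 = 0.
Proof. by case=> _ fZ _ _ _; rewrite -(scale0r 0) fZ// scale0r. Qed.

Lemma cstar_subalgebra_preimage A B (f : A -> B) (D : set B) :
  star_hom_on setT f -> cstar_subalgebra D -> cstar_subalgebra (f @^-1` D).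
Proof.
move=> hf [Dc [D0 DD] DZ DM Ds]; have [fD fZ fM f1 fs] := hf; split => /=.
- exact: cnorm_closed_preimage (star_hom_dist hf) Dc.
- by split=> [|x y]; rewrite /preimage /= ?star_hom0// fD//; exact: DD.
- by move=> a x; rewrite /preimage /= fZ//; exact: DZ.
- by move=> x y; rewrite /preimage /= fM//; exact: DM.
- by move=> x; rewrite /preimage /= fs//; exact: Ds.
Qed.

Lemma equalizer_subalgebra A B (f g : A -> B) :
  star_hom_on setT f -> star_hom_on setT g ->
  cstar_subalgebra [set x | f x = g x].
Proof.
move=> hf hg; have [fD fZ fM f1 fs] := hf; have [gD gZ gM g1 gs] := hg; split.
- apply/cnorm_closed_approx => x hx; apply/eqP; rewrite -subr_eq0.
  apply/eqP/cnorm_le0 => e e0; have [|y fgy le] := hx (e / 2).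
    by rewrite divr_gt0.
  apply: le_trans (cnorm_dist_trans (f y) _ _) _; rewrite {2}fgy.
  have := star_hom_dist hf x y; have := star_hom_dist hg y x.
  rewrite (cnorm_distC y); lra.
- by split=> [|x y /= hx hy]; rewrite /= ?star_hom0// fD// gD// hx hy.
- by move=> a x /= hx; rewrite fZ// gZ// hx.
- by move=> x y /= hx hy; rewrite fM// gM// hx hy.
- by move=> x /= hx; rewrite fs// gs// hx.
Qed.

Lemma star_hom_gen_eq A B (X : set A) (f g : A -> B) :
  star_hom_on setT f -> star_hom_on setT g -> (forall x, X x -> f x = g x) ->
  forall x, cstar_gen X x -> f x = g x.
Proof.
move=> hf hg fg x hx; apply: (hx [set y | f y = g y]) => //.
exact: equalizer_subalgebra.
Qed.

Lemma commutant_subalgebra A (X : set A) : (forall x, X x -> X (star x)) ->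
  cstar_subalgebra [set y | forall x, X x -> y * x = x * y].
Proof.
move=> Xs; split.
- apply/cnorm_closed_approx => y hy x Xx; apply/eqP; rewrite -subr_eq0.
  apply/eqP/cnorm_le0 => e e0; have nx := cnorm_ge0 x.
  have [|z hz le] := hy (e / (2 * (1 + cnorm x))).
    by rewrite divr_gt0// mulr_gt0//; lra.
  apply: le_trans (cnorm_dist_trans (z * x) _ _) _; rewrite {2}hz//.
  rewrite -mulrBl -mulrBr.
  have := cnormM_le le (lexx (cnorm x)).
  rewrite cnorm_distC in le; have := cnormM_le (lexx (cnorm x)) le.
  set d := e / _; have -> : e = d * (2 * (1 + cnorm x)).
    by rewrite /d divfK// gt_eqF// mulr_gt0//; lra.
  have d0 : 0 <= d by apply: le_trans le; exact: cnorm_ge0.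
  nra.
- by split=> [x _|y z hy hz x Xx]; rewrite ?mul0r ?mulr0// mulrDl mulrDr hy ?hz.
- by move=> a y hy x Xx; rewrite -scalerAl -scalerAr hy.
- by move=> y z hy hz x Xx; rewrite -mulrA hz// mulrA hy// mulrA.
- by move=> y hy x Xx; rewrite -[x]starK -!starM hy//; exact: Xs.
Qed.

(** Two passes through commutants: first the commutant of [X] absorbs [cstar_gen X], then the
    commutant of [cstar_gen X], which now contains [X], absorbs it too. *)
Lemma commute_comm A (X : set A) : (forall x, X x -> star x = x) ->
  (forall x y, X x -> X y -> x * y = y * x) ->
  forall x y, cstar_gen X x -> cstar_gen X y -> x * y = y * x.
Proof.
move=> Xs XX x y hx hy.
have hX z u : cstar_gen X z -> X u -> z * u = u * z.
  move=> hz; apply: (hz [set z | forall u, X u -> z * u = u * z]).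
    by apply: commutant_subalgebra => v Xv; rewrite Xs.
  by move=> v Xv w Xw; exact: XX.
apply: (hx [set y | forall x, cstar_gen X x -> y * x = x * y]) => //.
  by apply: commutant_subalgebra => z; have [_ _ _ _] := cstar_gen_subalgebra X; apply.
by move=> u Xu v hv; apply/esym; exact: hX.
Qed.

Lemma star_aut_inv A (f : A -> A) : star_aut_on setT f ->
  exists g, [/\ star_aut_on setT g, cancel f g & cancel g f].
Proof.
move=> [[fD fZ fM f1 fs] [_ finj fsurj]].
have /choice[g fg] y : exists x, f x = y by have [x _] := fsurj y I; exists x.
have fi x y : f x = f y -> x = y by move=> h; apply: finj; rewrite ?inE.
have gf x : g (f x) = x by apply: fi; rewrite fg.
exists g; split; [|exact: gf|exact: fg]; split; last first.
  split=> [//|x y _ _ h|y _]; first by rewrite -(fg x) h fg.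
  by exists (f y).
split=> [x y _ _|a x _|x y _ _||x _]; apply: fi; rewrite ?fD ?fZ ?fM ?f1 ?fs//.
all: by rewrite ?fg// fD// !fg.
Qed.

Lemma star_hom_comp A (f g : A -> A) :
  star_hom_on setT f -> star_hom_on setT g -> star_hom_on setT (f \o g).
Proof.
move=> [fD fZ fM f1 fs] [gD gZ gM g1 gs].
split=> [x y _ _|a x _|x y _ _||x _] /=.
- by rewrite gD// fD.
- by rewrite gZ// fZ.
- by rewrite gM// fM.
- by rewrite g1.
- by rewrite gs// fs.
Qed.

Lemma star_aut_comp A (f g : A -> A) :
  star_aut_on setT f -> star_aut_on setT g -> star_aut_on setT (f \o g).
Proof.
move=> [hf bf] [hg bg]; split; first exact: star_hom_comp.
exact: set_bij_comp bg bf.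
Qed.

(** If [x = M * (1 + d)] with [d > 0], Bernoulli's inequality pushes [(1 + d) ^ (2 ^ n)] above 2;
    the case [M = 0] is settled by [n = 0]. *)
Lemma ler_of_expr2n (x M : R) : 0 <= x -> 0 <= M ->
  (forall n, x ^+ (2 ^ n) <= 2 * M ^+ (2 ^ n)) -> x <= M.
Proof.
move=> x0 M0 h; rewrite leNgt; apply/negP => Mx.
have [M00|M1] : M = 0 \/ 0 < M.
  by move: M0; rewrite le_eqVlt => /predU1P[->|]; [left|right].
  by have := h 0%N; rewrite M00 !expr1; lra.
set d := (x - M) / M; have d0 : 0 < d by rewrite divr_gt0// subr_gt0.
have xM : x = M * (1 + d) by rewrite /d; field; rewrite gt_eqF.
have bern n : 1 + n%:R * d <= (1 + d) ^+ n.
  elim: n => [|n IH]; first by rewrite mul0r addr0 expr0.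
  rewrite exprS -natr1; have : 0 <= n%:R * d by rewrite mulr_ge0// ltW.
  nra.
set n := Num.truncn d^-1; have nd : 1 < (2 ^ n)%N%:R * d.
  rewrite -ltr_pdivrMr// div1r; apply: lt_le_trans (truncnS_gt _) _.
  by rewrite ler_nat ltn_expl.
have := h n; rewrite xM exprMn mulrC ler_pM2r ?exprn_gt0//.
have := bern (2 ^ n)%N; lra.
Qed.

(* The C*-identity applied to [x] repeatedly replaces [2] in the trivial bound
   [cnorm x <= 2 * M] by its roots of order [2 ^ n]. *)
Lemma cnorm_orthogonal_sum A (s1 s2 a b : A) (M : R) :
  isometry_elt s1 -> isometry_elt s2 -> star s1 * s2 = 0 ->
  cnorm a <= M -> cnorm b <= M ->
  cnorm (s1 * a * star s1 + s2 * b * star s2) <= M.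
Proof.
move=> i1 i2 o12 aM bM; have M0 : 0 <= M := le_trans (cnorm_ge0 a) aM.
have o21 : star s2 * s1 = 0 by rewrite -(starK s1) -starM o12 star0.
apply: ler_of_expr2n => //; first exact: cnorm_ge0.
move=> n; elim: n a b M aM bM M0 => [|n IH] a b M aM bM M0.
  rewrite !expr1; apply: le_trans (cnormD _ _) _.
  have bd (s c : A) : isometry_elt s -> cnorm c <= M -> cnorm (s * c * star s) <= M.
    move=> is_ cM; rewrite -(mulr1 M) -(mul1r M).
    apply: cnormM_le; last by rewrite cnorm_star cnorm_isometry.
    by apply: cnormM_le => //; rewrite cnorm_isometry.
  have := bd _ _ i1 aM; have := bd _ _ i2 bM; lra.
rewrite expnS !exprM -cstar_id expr2.
(* Orthogonality kills the cross terms, so the square has the same shape, with [star a * a],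
   [star b * b] and the bound [M * M]. *)
rewrite [X in cnorm X](_ : _ = s1 * (star a * a) * star s1 + s2 * (star b * b) * star s2).
  apply: IH; last exact: mulr_ge0.
  - by apply: cnormM_le; rewrite ?cnorm_star.
  - by apply: cnormM_le; rewrite ?cnorm_star.
rewrite starD !starM !starK mulrDl !mulrDr !mulrA.
rewrite -[_ * star s1 * s1]mulrA i1 -[_ * star s1 * s2]mulrA o12.
rewrite -[_ * star s2 * s1]mulrA o21 -[_ * star s2 * s2]mulrA i2.
by rewrite !mulr0 !mul0r !mulr1 addr0 add0r.
Qed.

End Subalgebras.

(** * Averaging over orthogonal shifts, for polynomials in an isometry and its adjoint *)

Section ToeplitzAverage.
Variables (R : realType) (A : cstarType R) (s T : A).
Hypotheses (s_iso : isometry_elt s) (T_iso : isometry_elt T).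
Hypothesis Ts0 : star T * s = 0.

Lemma scale_natC (x : A) n : x *+ n = ((n%:R : R)%:C)%C *: x.
Proof. by rewrite -scaler_nat (rmorph_nat (real_complex R)). Qed.

(** The head [s ^ j * T] separates the ranges. The tail is such that [s ^ r * slot L j = slot L (r +
    j) * s ^ r] for [r + j <= L], which lets the average reproduce [s ^ r]. *)
Definition slot (L j : nat) : A := s ^+ j * T * s ^+ (L - j).

Definition slot_sum (L : nat) : A := \sum_(j < L) slot L j.

(** For [L > 0] this is compression by the isometry [slot_sum L / sqrt L]; the scalar is pulled out
    to avoid the square root. *)
Definition slot_avg (L : nat) (x : A) : A :=
  ((L%:R^-1 : R)%:C)%C *: (star (slot_sum L) * x * slot_sum L).

(* [c%:A] is the diagonal of [p], and [slot_avg] recovers [p] itself. *)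
Definition toeplitz_symbol (p : A) (c : R[i]) : Prop :=
  (forall L j, (j < L)%N -> star (slot L j) * p * slot L j = c%:A) /\
  (forall e : R, 0 < e -> exists L0 : nat, forall L : nat, (L0 <= L)%N ->
     cnorm (slot_avg L p - p) <= e).

Lemma isometryX (t : A) n : isometry_elt t -> isometry_elt (t ^+ n).
Proof.
rewrite /isometry_elt => h; elim: n => [|n IH]; first by rewrite star1 mulr1.
by rewrite exprS starM mulrA -[_ * star t * t]mulrA h mulr1.
Qed.

Lemma isometryM (t u : A) :
  isometry_elt t -> isometry_elt u -> isometry_elt (t * u).
Proof.
rewrite /isometry_elt => ht hu.
by rewrite starM mulrA -[_ * star t * t]mulrA ht mulr1.
Qed.

Lemma isometry_expr_le (t : A) i j : isometry_elt t -> (i <= j)%N ->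
  star (t ^+ i) * t ^+ j = t ^+ (j - i).
Proof.
move=> ht ij; rewrite -{1}(subnKC ij) exprD mulrA.
by rewrite (isometryX i ht) mul1r.
Qed.

Lemma slot_isometry L j : isometry_elt (slot L j).
Proof. by do !apply: isometryM => //; exact: isometryX. Qed.

(** Unequal exponents leave a positive power of [s] next to [star T], or of [star s] next to [T],
    and both products vanish. *)
Lemma slot_base_shift i j r :
  star (s ^+ i * T) * s ^+ r * (s ^+ j * T) = (i == r + j)%N%:R.
Proof.
rewrite starM !mulrA -[_ * s ^+ r * s ^+ j]mulrA -exprD.
rewrite -[star T * _ * _]mulrA.
case: eqVneq => [->|ne]; first by rewrite isometryX// mulr1.
have [lt|ge] := ltnP i (r + j).
  rewrite isometry_expr_le ?(ltnW lt)//.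
  have -> : (r + j - i = (r + j - i).-1.+1)%N by lia.
  by rewrite exprS !mulrA Ts0 !mul0r.
have -> : star (s ^+ i) * s ^+ (r + j) = star (s ^+ (i - (r + j))).
  by rewrite -[LHS]starK starM starK isometry_expr_le.
have -> : (i - (r + j) = (i - (r + j)).-1.+1)%N by lia.
have sT : star s * T = 0 by rewrite -(starK T) -starM Ts0 star0.
by rewrite exprS starM -!mulrA sT !mulr0.
Qed.

Lemma slot_shift L i j r : (i < L)%N -> (j < L)%N ->
  star (slot L i) * s ^+ r * slot L j = if i == (r + j)%N then s ^+ r else 0.
Proof.
move=> iL jL; rewrite /slot starM.
have -> : star (s ^+ (L - i)) * star (s ^+ i * T) * s ^+ r * (s ^+ j * T * s ^+ (L - j)) =
    star (s ^+ (L - i)) * (star (s ^+ i * T) * s ^+ r * (s ^+ j * T)) * s ^+ (L - j).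
  by rewrite !mulrA.
rewrite slot_base_shift; case: eqVneq iL => [->|ne] iL; last by rewrite mulr0 mul0r.
by rewrite mulr1 isometry_expr_le//; [congr (s ^+ _)|]; lia.
Qed.

Lemma slot_sum_conj L (x : A) :
  star (slot_sum L) * x * slot_sum L =
  \sum_(i < L) \sum_(j < L) star (slot L i) * x * slot L j.
Proof.
rewrite star_sum !mulr_suml; apply: eq_bigr => i _.
by rewrite mulr_sumr; apply: eq_bigr.
Qed.

(** Only the slots [j < L - r] stay in the window after a shift by [r], and each contributes one
    [s ^ r]; the average thus loses the fraction [r / L]. *)
Lemma slot_sum_shift L r : (r <= L)%N ->
  star (slot_sum L) * s ^+ r * slot_sum L = s ^+ r *+ (L - r).
Proof.
move=> rL; rewrite slot_sum_conj exchange_big /=.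
have -> : \sum_(j < L) \sum_(i < L) star (slot L i) * s ^+ r * slot L j =
    \sum_(j < L) (if (j < L - r)%N then s ^+ r else 0).
  apply: eq_bigr => j _.
  under eq_bigr => i _ do rewrite slot_shift//.
  rewrite -big_mkcond /=; case: ltnP => h.
    have h' : (r + j < L)%N by lia.
    by rewrite (big_pred1 (Ordinal h')).
  by rewrite big1// => i /eqP ei; have := ltn_ord i; lia.
rewrite -big_mkcond /= (big_ord_narrow (leq_subr r L)) /=.
by rewrite sumr_const card_ord.
Qed.

(** By the C*-identity [cnorm (slot_sum L) ^ 2 = L], which the factor [1 / L] compensates. *)
Lemma slot_avg_contractive L x : (0 < L)%N -> cnorm (slot_avg L x) <= cnorm x.
Proof.
move=> L0; have LR : 0 < L%:R :> R by rewrite ltr0n.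
rewrite /slot_avg cnormZr ger0_norm ?invr_ge0 ?ler0n// ler_pdivrMl//.
have W2 : cnorm (slot_sum L) ^+ 2 = L%:R.
  rewrite -cstar_id -[star _]mulr1 -(expr0 s) slot_sum_shift//.
  by rewrite subn0 expr0 scale_natC cnormZr ger0_norm ?ler0n// cnorm1 mulr1.
rewrite -W2 expr2 mulrAC; apply: cnormM_le => //.
by apply: cnormM_le; rewrite ?cnorm_star.
Qed.

Lemma slot_avgD L x y : slot_avg L (x + y) = slot_avg L x + slot_avg L y.
Proof. by rewrite /slot_avg mulrDr mulrDl scalerDr. Qed.

Lemma slot_avgZ L a x : slot_avg L (a *: x) = a *: slot_avg L x.
Proof. by rewrite /slot_avg -scalerAr -scalerAl scalerA mulrC -scalerA. Qed.

Lemma slot_avg_star L x : slot_avg L (star x) = star (slot_avg L x).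
Proof. by rewrite /slot_avg starZ conjcR !starM starK mulrA. Qed.

Lemma toeplitz_symbolD p q c d : toeplitz_symbol p c -> toeplitz_symbol q d ->
  toeplitz_symbol (p + q) (c + d).
Proof.
move=> [hp1 hp2] [hq1 hq2]; split=> [L j jL|e e0].
  by rewrite mulrDr mulrDl hp1// hq1// scalerDl.
have e20 : 0 < e / 2 by rewrite divr_gt0.
have [L1 h1] := hp2 _ e20; have [L2 h2] := hq2 _ e20.
exists (maxn L1 L2) => L; rewrite geq_max => /andP[/h1 l1 /h2 l2].
rewrite slot_avgD opprD addrACA; apply: le_trans (cnormD _ _) _; lra.
Qed.

Lemma toeplitz_symbolZ a p c : toeplitz_symbol p c -> toeplitz_symbol (a *: p) (a * c).
Proof.
move=> [hp1 hp2]; split=> [L j jL|e e0].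
  by rewrite -scalerAr -scalerAl hp1// scalerA.
have na : 0 <= normc a by rewrite -(mulr1 (normc a)) -(cnorm1 A) -cnormZ cnorm_ge0.
have [|L0 h] := hp2 (e / (normc a + 1)); first by rewrite divr_gt0// ltr_wpDl.
exists L0 => L /h l; rewrite slot_avgZ -scalerBr cnormZ.
move: l; rewrite ler_pdivlMr ?ltr_wpDl//; have := cnorm_ge0 (slot_avg L p - p); nra.
Qed.

Lemma toeplitz_symbol_star p c : toeplitz_symbol p c ->
  toeplitz_symbol (star p) (conjc c).
Proof.
move=> [hp1 hp2]; split=> [L j jL|e /hp2[L0 h]].
  by rewrite -[slot L j in X in _ * X]starK -!starM mulrA hp1// starZ star1.
by exists L0 => L /h; rewrite slot_avg_star -starB cnorm_star.
Qed.

Lemma toeplitz_symbolX r : toeplitz_symbol (s ^+ r) (r == 0)%:R.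
Proof.
split=> [L j jL|e e0].
  rewrite slot_shift// -[X in X == _]add0n eqn_add2r eq_sym.
  by case: eqVneq => [->|_]; rewrite ?scale1r ?scale0r ?expr0.
(* [L >= r] keeps [L - r] from truncating, [L >= 1] allows division, and [L > r / e] makes the error
   [r / L] at most [e]. *)
exists (maxn (maxn r 1) (Num.truncn (r%:R / e)).+1) => L.
rewrite !geq_max => /andP[/andP[rL L1] hL].
have LR : 0 < L%:R :> R by rewrite ltr0n.
rewrite /slot_avg slot_sum_shift// scale_natC scalerA -rmorphM.
rewrite -[X in _ - X]scale1r -(rmorph1 (real_complex R)) -scalerBl -rmorphB.
rewrite cnormZr cnorm_isometry ?mulr1; last exact: isometryX.
rewrite natrB// mulrBr mulVf ?gt_eqF// addrC addKr normrN ger0_norm; last first.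
  by rewrite mulr_ge0// invr_ge0.
rewrite ler_pdivrMl//; apply: ltW; rewrite -ltr_pdivrMr//.
by apply: lt_le_trans (truncnS_gt _) _; rewrite ler_nat.
Qed.

Lemma toeplitz_symbol0 : toeplitz_symbol 0 0.
Proof. by have := toeplitz_symbolZ 0 (toeplitz_symbolX 0); rewrite scale0r mul0r. Qed.

(** Write [b] as [b * star b * b] and move the projection [b * star b] past [x], where [star a]
    kills it. *)
Lemma commuting_offdiag (a b x : A) : isometry_elt b -> star a * b = 0 ->
  x * (b * star b) = b * star b * x -> star a * x * b = 0.
Proof.
move=> b_iso ab xb; rewrite -[b]mulr1 -b_iso 2!mulrA -[_ * b * star b]mulrA.
by rewrite -[star a * x * _]mulrA xb !mulrA ab !mul0r.
Qed.

(* Averaging over the slots, which lie under orthogonal projections commuting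
   with [x], sends [x] close to the diagonal of [p]; the same average fixes [p]. *)
Lemma toeplitz_rigidity x p c e :
  (forall j, x * (s ^+ j * T * star (s ^+ j * T)) =
             s ^+ j * T * star (s ^+ j * T) * x) ->
  toeplitz_symbol p c -> cnorm (x - p) <= e -> cnorm (x - c%:A) <= 3 * e.
Proof.
move=> xq [hp1 hp2] xp; apply/ler_addgt0Pl => d d0.
have [L0 hL] := hp2 _ d0; set L := L0.+1.
have L_gt0 : (0 < L)%N by [].
have LR : 0 < L%:R :> R by rewrite ltr0n.
have offdiag i j : i != j -> star (slot L i) * x * slot L j = 0.
  move=> ij; pose t k := s ^+ k * T.
  have t_iso k : isometry_elt (t k) by apply: isometryM => //; exact: isometryX.
  have tt : star (t i) * t j = 0.
    by have := slot_base_shift i j 0; rewrite expr0 mulr1 add0n (negbTE ij).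
  have -> : star (slot L i) * x * slot L j =
      star (s ^+ (L - i)) * (star (t i) * x * t j) * s ^+ (L - j).
    by rewrite /slot starM !mulrA.
  by rewrite (commuting_offdiag (t_iso j) tt (xq j)) mulr0 mul0r.
have h1 : cnorm (slot_avg L x - c%:A) <= e.
  have -> : slot_avg L x - c%:A =
     ((L%:R^-1 : R)%:C)%C *: \sum_(j < L) (star (slot L j) * (x - p) * slot L j).
    under eq_bigr => j _ do rewrite mulrBr mulrBl hp1//.
    rewrite big_split /= scalerDr; congr (_ + _); last first.
      rewrite sumr_const card_ord scale_natC scalerA -rmorphM.
      by rewrite mulVf ?gt_eqF// rmorph1 scale1r.
    rewrite /slot_avg slot_sum_conj; congr (_ *: _); apply: eq_bigr => i _.
    rewrite (bigD1 i)//= big1 ?addr0// => j ji; apply: offdiag.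
    by rewrite eq_sym.
  rewrite cnormZr gtr0_norm ?invr_gt0// ler_pdivrMl//.
  apply: le_trans (cnorm_sum _ _ _) _; rewrite mulr_natl.
  rewrite -[X in _ *+ X]card_ord -sumr_const; apply: ler_sum => j _.
  rewrite -[e]mulr1 -[e]mul1r; have := cnorm_isometry (slot_isometry L j) => n1.
  by apply: cnormM_le; rewrite ?n1//; apply: cnormM_le; rewrite ?cnorm_star ?n1.
have h2 : cnorm (slot_avg L p - slot_avg L x) <= e.
  rewrite cnorm_distC -[- slot_avg L p]scaleN1r -slot_avgZ -slot_avgD scaleN1r.
  exact: le_trans (slot_avg_contractive _ L_gt0) xp.
have h3 := hL L (leqnSn _); rewrite cnorm_distC in h3.
(* The chain [x], [p], [slot_avg L p], [slot_avg L x], [c%:A] costs [e], [d], [e], [e]. *)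
have := cnorm_dist_trans p x c%:A; have := cnorm_dist_trans (slot_avg L p) p c%:A.
have := cnorm_dist_trans (slot_avg L x) (slot_avg L p) c%:A; lra.
Qed.

End ToeplitzAverage.

(** * Monomials [U ^ a * S ^ m] as affine maps of the integers *)

Section AffineMonomials.
Variables (R : realType) (A : cstarType R) (S U : A).
Hypothesis rel : Q2_relations S U.

Definition upow (a : int) : A :=
  match a with Posz n => U ^+ n | Negz n => star U ^+ n.+1 end.

Definition aff (a : int) (m : nat) : A := upow a * S ^+ m.

Lemma S_iso : isometry_elt S. Proof. by case: rel. Qed.
Lemma sUU : star U * U = 1. Proof. by case: rel => _ []. Qed.
Lemma UsU : U * star U = 1. Proof. by case: rel => _ []. Qed.

Lemma upowS a : upow (a + 1) = U * upow a.
Proof.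
case: a => n; first by rewrite -PoszD addn1 /= exprS.
case: n => [|n]; first by rewrite /= expr1 UsU.
have -> : Negz n.+1 + 1 = Negz n by lia.
by rewrite /= [in RHS]exprS mulrA UsU mul1r.
Qed.

Lemma upowB1 a : upow (a - 1) = star U * upow a.
Proof. by rewrite -[in RHS](subrK 1 a) upowS mulrA sUU mul1r. Qed.

Lemma upowD a b : upow (a + b) = upow a * upow b.
Proof.
elim/int_ind: a => [|n IH|n IH]; first by rewrite add0r mul1r.
  by rewrite -addn1 PoszD addrAC upowS IH upowS mulrA.
have -> : - n.+1%:Z = - n%:Z - 1 by lia.
by rewrite addrAC upowB1 IH upowB1 mulrA.
Qed.

Lemma upowN a : star (upow a) = upow (- a).
Proof.
have e : upow (- a) * upow a = 1 by rewrite -upowD addNr.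
have e' : star (upow a) * upow a = 1.
  case: a {e} => n /=; apply: (isometryX _ _); first exact: sUU.
  by rewrite /isometry_elt starK UsU.
have e2 : upow a * upow (- a) = 1 by rewrite -upowD subrr.
by rewrite -[LHS]mulr1 -e2 mulrA e' mul1r.
Qed.

Lemma S_upow a m : S ^+ m * upow a = upow (2 ^+ m * a) * S ^+ m.
Proof.
have SU b : S * upow b = upow (2 * b) * S.
  have SU1 : S * U = U ^+ 2 * S by case: rel.
  elim/int_ind: b => [|n IH|n IH]; first by rewrite mulr0 /= mulr1 mul1r.
    rewrite -addn1 PoszD addrC upowD mulrA (_ : upow 1 = U) ?SU1// -mulrA IH mulrA.
    by rewrite mulrDr upowD.
  have -> : - n.+1%:Z = -1 - n%:Z by lia.
  have SU' : S * star U = star U ^+ 2 * S.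
    have e : star U ^+ 2 * U ^+ 2 = 1 by rewrite -starX; apply: isometryX; exact: sUU.
    by rewrite -[LHS]mul1r -e -mulrA (mulrA (U ^+ 2)) -SU1 -(mulrA S) UsU mulr1.
  rewrite upowD mulrA (_ : upow (-1) = star U) ?SU'// -mulrA IH mulrA.
  by rewrite mulrDr upowD.
elim: m => [|m IH]; first by rewrite expr0 !mul1r mulr1.
by rewrite exprS -mulrA IH mulrA SU -mulrA -exprS mulrA -exprS.
Qed.

(** Composition of affine maps: [2 ^ m * (2 ^ n * k + b) + a]. *)
Lemma affM a m b n : aff a m * aff b n = aff (a + 2 ^+ m * b) (m + n).
Proof. by rewrite /aff mulrA -[_ * S ^+ m * _]mulrA S_upow upowD exprD !mulrA. Qed.

Lemma aff_iso a m : isometry_elt (aff a m).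
Proof.
apply: isometryM; last by apply: isometryX; exact: S_iso.
by rewrite /isometry_elt upowN -upowD addNr.
Qed.

Lemma aff00 : aff 0 0 = 1. Proof. by rewrite /aff !expr0 mulr1. Qed.
Lemma aff_S : aff 0 1 = S. Proof. by rewrite /aff mul1r expr1. Qed.
Lemma aff_US : aff 1 1 = U * S. Proof. by rewrite /aff expr1. Qed.

Lemma range_sum : S * star S + U * S * star (U * S) = 1.
Proof. by case: rel => _ _ <- _; rewrite starM !mulrA. Qed.

(** Compressing [range_sum] by [S] gives [1 + star x * x = 1], where [x] is the adjoint of the
    product. *)
Lemma sSUS : star S * (U * S) = 0.
Proof.
rewrite -[LHS]starK; set x := star (star S * (U * S)).
have : star S * (S * star S + U * S * star (U * S)) * S = 1.
  by rewrite range_sum mulr1; exact: S_iso.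
rewrite mulrDr mulrDl !mulrA S_iso mul1r S_iso => /eqP.
rewrite -[X in _ == X]addr0 (inj_eq (addrI _)) => /eqP xx.
rewrite (_ : x = 0) ?star0//; apply: cnorm_eq0P.
by rewrite /x starK !starM starK !mulrA -[RHS]xx starM !mulrA.
Qed.

Lemma sUSS : star (U * S) * S = 0.
Proof. by rewrite -[S in X in _ * X]starK -starM sSUS star0. Qed.

(** Halve the exponent [m] times: an even power of [U] passes through [S], an odd one sends the
    range of [S] into that of [U * S], which is orthogonal. *)
Lemma S_upow_S m a :
  star (S ^+ m) * upow a * S ^+ m = 0 \/
  exists2 c, a = 2 ^+ m * c & star (S ^+ m) * upow a * S ^+ m = upow c.
Proof.
elim: m a => [|m IH] a.
  by right; exists a; rewrite ?expr0 ?mul1r// star1 mul1r mulr1.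
have E : star (S ^+ m.+1) * upow a * S ^+ m.+1 =
    star (S ^+ m) * (star S * upow a * S) * S ^+ m.
  by rewrite [S ^+ m.+1]exprS starM !mulrA.
rewrite E; set b := (a %/ 2)%Z.
have [ab|ab] : a = 2 * b \/ a = 2 * b + 1.
- by rewrite /b; lia.
- have -> : star S * upow a * S = upow b.
    have := S_upow b 1; rewrite !expr1 -mulrA ab => <-.
    by rewrite mulrA S_iso mul1r.
  have [->|[c bc ->]] := IH b; [by left|right; exists c => //].
  by rewrite ab bc exprS mulrA.
- left; have -> : star S * upow a * S = 0; last by rewrite mulr0 mul0r.
  have e := S_upow b 1; rewrite !expr1 in e.
  by rewrite ab upowS -!mulrA -e !mulrA -(mulrA (star S)) sSUS mul0r.
Qed.

(** The ranges correspond to the classes of [a] modulo [2 ^ m] and of [b] modulo [2 ^ n]; two such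
    classes are disjoint or nested. *)
Lemma aff_adj_mul a m b n : (m <= n)%N ->
  star (aff a m) * aff b n = 0 \/
  exists2 c, b = a + 2 ^+ m * c & star (aff a m) * aff b n = aff c (n - m).
Proof.
move=> mn.
have E : star (aff a m) * aff b n =
    star (S ^+ m) * upow (b - a) * S ^+ m * S ^+ (n - m).
  by rewrite -mulrA -exprD subnKC// /aff starM upowN addrC upowD !mulrA.
rewrite E; have [->|[c bc ->]] := S_upow_S m (b - a); first by left; rewrite mul0r.
by right; exists c => //; rewrite -bc; lia.
Qed.

Lemma word_aff w : exists c, cuntz_word S U w = aff c (size w).
Proof.
elim: w => [|i w [c IH]]; first by exists 0; rewrite /cuntz_word big_nil aff00.
rewrite /cuntz_word big_cons -/(cuntz_word S U w) IH.
have -> : cuntz_gen S U i = aff (i : nat)%:Z 1 by case: i; rewrite ?aff_US ?aff_S.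
by rewrite affM; exists (i%:Z + 2 ^+ 1 * c).
Qed.

(** The word lists the [m] lowest binary digits of [a], lowest first, and [q] is what remains of [a]
    after removing them. *)
Lemma aff_word a m : exists w q, size w = m /\ aff a m = cuntz_word S U w * upow q.
Proof.
elim: m a => [|m IH] a.
  by exists [::], a; split=> //; rewrite /cuntz_word big_nil /aff mulr1 mul1r.
have [w [q [sw wq]]] := IH (a %/ 2)%Z.
exists (((a %% 2)%Z == 1) :: w), q; rewrite /= sw; split=> //.
rewrite /cuntz_word big_cons -/(cuntz_word S U w) -mulrA -wq.
set i := _ == _; have -> : cuntz_gen S U i = aff (i : nat)%:Z 1.
  by case: (i); rewrite ?aff_US ?aff_S.
by rewrite affM add1n expr1; congr (aff _ _); rewrite /i; case: eqP; lia.
Qed.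

Lemma cuntz_word_iso w : isometry_elt (cuntz_word S U w).
Proof. by have [c ->] := word_aff w; exact: aff_iso. Qed.

Lemma aff_proj a m : exists w, aff a m * star (aff a m) = cuntz_proj S U w.
Proof.
have [w [q [_ ->]]] := aff_word a m; exists w; rewrite /cuntz_proj.
by rewrite starM mulrA -[_ * upow q * _]mulrA upowN -upowD subrr mulr1.
Qed.

Lemma cuntz_proj_aff w : exists a m, cuntz_proj S U w = aff a m * star (aff a m).
Proof. by have [c e] := word_aff w; exists c, (size w); rewrite /cuntz_proj e. Qed.

Lemma cuntz_proj_star w : star (cuntz_proj S U w) = cuntz_proj S U w.
Proof. by rewrite /cuntz_proj starM starK. Qed.

Lemma cuntz_proj_comm v w :
  cuntz_proj S U v * cuntz_proj S U w = cuntz_proj S U w * cuntz_proj S U v.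
Proof.
have [a [m ->]] := cuntz_proj_aff v; have [b [n ->]] := cuntz_proj_aff w.
wlog mn : a m b n / (m <= n)%N.
  by move=> H; case: (leqP m n) => [|/ltnW] h; [exact: H|apply/esym/H].
have E : aff a m * star (aff a m) * (aff b n * star (aff b n)) =
    aff a m * (star (aff a m) * aff b n) * star (aff b n) by rewrite !mulrA.
have sa c k : star (aff c k * star (aff c k)) = aff c k * star (aff c k).
  by rewrite starM starK.
(* Self-adjoint factors commute once their product is self-adjoint; here the product is [0] or the
   smaller projection. *)
suff e : star (aff a m * star (aff a m) * (aff b n * star (aff b n))) =
    aff a m * star (aff a m) * (aff b n * star (aff b n)).
  by rewrite -e starM !sa.
rewrite E; have [->|[c bc ->]] := aff_adj_mul a b mn.
  by rewrite mulr0 mul0r star0.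
by rewrite affM -bc subnKC// sa.
Qed.

Lemma conj_proj_aff a m w :
  exists w', aff a m * cuntz_proj S U w * star (aff a m) = cuntz_proj S U w'.
Proof.
have [b [n ->]] := cuntz_proj_aff w; have [w' e] := aff_proj (a + 2 ^+ m * b) (m + n).
exists w'; rewrite -e -(affM a m b n).
by rewrite (starM (aff a m)) !mulrA.
Qed.

End AffineMonomials.

(** * A dense *-subalgebra spanned by monomials *)

Section Density.
Variables (R : realType) (A : cstarType R) (S U : A).
Hypothesis rel : Q2_relations S U.

Definition aff_index := ((int * nat) * (int * nat))%type.

Definition aff_term (t : aff_index) : A :=
  aff S U t.1.1 t.1.2 * star (aff S U t.2.1 t.2.2).

Definition aff_comb (l : seq (R[i] * aff_index)) : A :=
  \sum_(t <- l) t.1 *: aff_term t.2.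

Definition aff_span : set A := range aff_comb.

Lemma aff_span0 : aff_span 0.
Proof. by exists [::] => //; rewrite /aff_comb big_nil. Qed.

Lemma aff_spanD x y : aff_span x -> aff_span y -> aff_span (x + y).
Proof. by move=> [l _ <-] [l' _ <-]; exists (l ++ l') => //; rewrite /aff_comb big_cat. Qed.

Lemma aff_spanZ a x : aff_span x -> aff_span (a *: x).
Proof.
move=> [l _ <-]; exists [seq (a * t.1, t.2) | t <- l] => //.
by rewrite /aff_comb big_map scaler_sumr; apply: eq_bigr => t _; rewrite scalerA.
Qed.

Lemma aff_span_term t : aff_span (aff_term t).
Proof. by exists [:: (1, t)] => //; rewrite /aff_comb big_seq1 scale1r. Qed.

Lemma aff_span_sum (I : Type) (r : seq I) (F : I -> A) :
  (forall i, aff_span (F i)) -> aff_span (\sum_(i <- r) F i).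
Proof.
move=> h; elim/big_ind: _ => //; [exact: aff_span0|exact: aff_spanD].
Qed.

Lemma aff_span_star x : aff_span x -> aff_span (star x).
Proof.
move=> [l _ <-]; rewrite star_sum; apply: aff_span_sum => -[a [t u]].
by rewrite starZ starM starK; apply: aff_spanZ; exact: (aff_span_term (u, t)).
Qed.

(** The two inner factors collapse to [0], to a monomial or to the adjoint of one, and the outer
    factors absorb it. *)
Lemma aff_span_termM t u : aff_span (aff_term t * aff_term u).
Proof.
move: t u => [[a m] [b n]] [[c p] [d q]]; rewrite /aff_term /=.
have -> : aff S U a m * star (aff S U b n) * (aff S U c p * star (aff S U d q)) =
    aff S U a m * (star (aff S U b n) * aff S U c p) * star (aff S U d q).
  by rewrite !mulrA.
have [np|/ltnW pn] := leqP n p.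
  have [->|[e _ ->]] := aff_adj_mul rel b c np.
    by rewrite mulr0 mul0r; exact: aff_span0.
  by rewrite affM//; exact: (aff_span_term ((_, _), (_, _))).
rewrite -[star (aff S U b n) * _]starK (starM (star _)) starK.
have [->|[e _ ->]] := aff_adj_mul rel c b pn.
  by rewrite star0 mulr0 mul0r; exact: aff_span0.
rewrite -mulrA -(starM (aff S U d q)) affM//.
exact: (aff_span_term ((_, _), (_, _))).
Qed.

Lemma aff_spanM x y : aff_span x -> aff_span y -> aff_span (x * y).
Proof.
move=> [l _ <-] [l' _ <-]; rewrite mulr_suml; apply: aff_span_sum => -[a t].
rewrite mulr_sumr; apply: aff_span_sum => -[b u] /=.
by rewrite -scalerAl -scalerAr; do 2!apply: aff_spanZ; exact: aff_span_termM.
Qed.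

Lemma aff_span_dense : cstar_gen [set S; U] = setT ->
  forall x (e : R), 0 < e -> exists2 y, aff_span y & cnorm (x - y) <= e.
Proof.
move=> gen x; have : cstar_gen [set S; U] x by rewrite gen.
move=> /(_ [set x | forall e : R, 0 < e -> exists2 y, aff_span y & cnorm (x - y) <= e]).
have span_mem y : aff_span y -> forall e : R, 0 < e -> exists2 z, aff_span z & cnorm (y - z) <= e.
  by move=> hy e e0; exists y => //; rewrite subrr cnorm0 ltW.
apply; last first.
  have one : aff_span 1.
    have := aff_span_term ((0, 0%N), (0, 0%N)).
    by rewrite /aff_term /= aff00 star1 mulr1.
  move=> y [->|->]; apply: span_mem.
    by have := aff_span_term ((0, 1%N), (0, 0%N)); rewrite /aff_term /= aff00 aff_S star1 mulr1.
  have := aff_span_term ((1, 0%N), (0, 0%N)).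
  by rewrite /aff_term /= aff00 star1 mulr1 /aff expr0 mulr1.
split.
- apply/cnorm_closed_approx => y hy e e0.
  have [|z hz yz] := hy (e / 2); first by rewrite divr_gt0.
  have [|u hu zu] := hz (e / 2); first by rewrite divr_gt0.
  exists u => //; apply: le_trans (cnorm_dist_trans z _ _) _; lra.
- split=> [|y z hy hz e e0]; first exact: span_mem aff_span0.
  have [|y' sy yy] := hy (e / 2); first by rewrite divr_gt0.
  have [|z' sz zz] := hz (e / 2); first by rewrite divr_gt0.
  exists (y' + z'); first exact: aff_spanD.
  rewrite opprD addrACA; apply: le_trans (cnormD _ _) _; lra.
- move=> a y hy e e0; have na : 0 <= normc a.
    by rewrite -(mulr1 (normc a)) -(cnorm1 A) -cnormZ cnorm_ge0.
  have [|y' sy yy] := hy (e / (normc a + 1)); first by rewrite divr_gt0// ltr_wpDl.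
  exists (a *: y'); first exact: aff_spanZ.
  rewrite -scalerBr cnormZ; move: yy; rewrite ler_pdivlMr ?ltr_wpDl//.
  have := cnorm_ge0 (y - y'); nra.
- move=> y z hy hz e e0; have ny := cnorm_ge0 y; have nz := cnorm_ge0 z.
  (* [z'] comes first because the tolerance for [y'] depends on [cnorm z']. *)
  have [|z' sz zz] := hz (e / (2 * (cnorm y + 1))).
    by rewrite divr_gt0// mulr_gt0// ltr_wpDl.
  have nz' := cnorm_ge0 z'.
  have [|y' sy yy] := hy (e / (2 * (cnorm z' + 1))).
    by rewrite divr_gt0// mulr_gt0// ltr_wpDl.
  exists (y' * z'); first exact: aff_spanM.
  apply: le_trans (cnorm_dist_trans (y * z') _ _) _; rewrite -mulrBr -mulrBl.
  have := cnormM y (z - z'); have := cnormM (y - y') z'.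
  move: yy zz; rewrite !ler_pdivlMr ?mulr_gt0 ?ltr_wpDl//.
  have := cnorm_ge0 (y - y'); have := cnorm_ge0 (z - z'); nra.
- move=> y hy e /hy[y' sy yy]; exists (star y'); first exact: aff_span_star.
  by rewrite -starB cnorm_star.
Qed.

End Density.

(** * Compressions to small dyadic balls, and the commutant of the diagonal *)

Section LocalScalars.
Variables (R : realType) (A : cstarType R) (S U : A).
Hypothesis rel : Q2_relations S U.

Let V := aff S U.

(** One of the truncated differences is zero, so this is the absolute difference of the two
    exponents of [S]. *)
Definition dilation (t : aff_index) : nat := ((t.1.2 - t.2.2) + (t.2.2 - t.1.2))%N.

(** A term acts as [k |-> 2 ^ (m - n) * (k - b) + a]. If [m <> n], its fixed point is
    [offset t / (2 ^ dilation t - 1)]; the second branch comes from the inverse map. *)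
Definition offset (t : aff_index) : int :=
  if (t.2.2 <= t.1.2)%N then 2 ^+ (t.1.2 - t.2.2) * t.2.1 - t.1.1
  else 2 ^+ (t.2.2 - t.1.2) * t.1.1 - t.2.1.

Lemma affX a m r : exists b n, V a m ^+ r = V b n.
Proof.
elim: r => [|r [b [n IH]]]; first by exists 0, 0%N; rewrite /V aff00.
by exists (a + 2 ^+ m * b), (m + n)%N; rewrite exprS IH /V affM.
Qed.

(** Substituting [k = 2 ^ N * j + c] in the affine map preserves its slope, and [2 ^ N * h] is the
    displacement of the centre [c]. *)
Lemma aff_term_conj_ge c N a m b n : (n <= m <= N)%N ->
  star (V c N) * aff_term S U ((a, m), (b, n)) * V c N = 0 \/
  exists h, 2 ^+ N * h = (2 ^+ (m - n) - 1) * c - (2 ^+ (m - n) * b - a) /\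
    star (V c N) * aff_term S U ((a, m), (b, n)) * V c N = V h (m - n).
Proof.
move=> /andP[nm mN]; rewrite /aff_term /= -/V.
have -> : star (V c N) * (V a m * star (V b n)) * V c N =
    star (star (V a m) * V c N) * (star (V b n) * V c N).
  by rewrite (starM (star _)) starK !mulrA.
have [->|[f cf ->]] := aff_adj_mul rel a c mN; first by left; rewrite star0 mul0r.
have [->|[g cg ->]] := aff_adj_mul rel b c (leq_trans nm mN); first by left; rewrite mulr0.
have le : (N - m <= N - n)%N by rewrite leq_sub2l.
have [->|[h gh ->]] := aff_adj_mul rel f g le; first by left.
right; exists h; split; last by congr (V _ _); lia.
have e1 : 2 ^+ N = 2 ^+ m * 2 ^+ (N - m) :> int by rewrite -exprD subnKC.
have e2 : 2 ^+ m = 2 ^+ (m - n) * 2 ^+ n :> int by rewrite -exprD subnK.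
have -> : (2 ^+ (m - n) - 1) * c - (2 ^+ (m - n) * b - a) =
    2 ^+ (m - n) * (c - b) - (c - a) by ring.
rewrite [in X in _ * X - _]cg [in X in _ - X]cf gh e1 e2; ring.
Qed.

Lemma aff_term_conj c N t : (t.1.2 <= N)%N -> (t.2.2 <= N)%N ->
  star (V c N) * aff_term S U t * V c N = 0 \/
  exists h, 2 ^+ N * h = (2 ^+ dilation t - 1) * c - offset t /\
    (star (V c N) * aff_term S U t * V c N = V h (dilation t) \/
     star (V c N) * aff_term S U t * V c N = star (V h (dilation t))).
Proof.
case: t => [[a m] [b n]] /= mN nN; rewrite /dilation /offset /=.
case: leqP => [nm|/ltnW mn].
  have -> : (m - n + (n - m) = m - n)%N by lia.
  have [|->|[h [e1 e2]]] := @aff_term_conj_ge c N a m b n; first by rewrite nm.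
    by left.
  by right; exists h; split=> //; left.
have -> : (m - n + (n - m) = n - m)%N by lia.
have E : star (V c N) * aff_term S U (a, m, (b, n)) * V c N =
    star (star (V c N) * aff_term S U ((b, n), (a, m)) * V c N).
  by rewrite /aff_term /= (starM (_ * _)) (starM (star _)) starK (starM (aff S U b n)) starK !mulrA.
rewrite E; have [|->|[h [e1 ->]]] := @aff_term_conj_ge c N b n a m; first by rewrite mn.
  by left; rewrite star0.
by right; exists h; split=> //; right.
Qed.

(* Affine maps with a common fixed point are powers of a single one, the one
   with the least dilation factor. *)
Lemma aff_common_root (h0 : int) k0 : (0 < k0)%N ->
  exists h d, (0 < d)%N /\ forall h' k,
    (2 ^+ k0 - 1) * h' = (2 ^+ k - 1) * h0 -> exists r, V h' k = V h d ^+ r.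
Proof.
move=> k0_gt0; pose D k : int := 2 ^+ k - 1.
have Dpos k : (0 < k)%N -> 0 < D k.
  by move=> k_gt0; rewrite subr_gt0 exprn_egt1// -lt0n.
(* Divisibility says that the map [x |-> 2 ^ k * x + h'] with the fixed point [- h0 / D k0] has an
   integer [h']. *)
pose P k := (0 < k)%N && (D k0 %| D k * h0)%Z.
have exP : exists k, P k by exists k0; rewrite /P k0_gt0 dvdz_mulr.
have [d /andP[d_gt0 /dvdzP[h hd]] dmin] := ex_minnP exP.
exists h, d; split=> // h' k; elim/ltn_ind: k h' => k IH h'.
rewrite -/(D k0) -/(D k) => hk.
have [k0'|k_gt0] := posnP k.
  exists 0%N; move: hk; rewrite k0' /D expr0 subrr mul0r => /eqP.
  by rewrite mulf_eq0 gt_eqF ?Dpos//= => /eqP ->; rewrite expr0 /V aff00.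
have dk : (d <= k)%N.
  by apply: dmin; rewrite /P k_gt0; apply/dvdzP; exists h'; rewrite -hk mulrC.
have e : 2 ^+ k = 2 ^+ (k - d) * 2 ^+ d :> int by rewrite -exprD subnK.
(* Splitting [V h d] off on the right lowers [k] by [d] and preserves the fixed-point equation. *)
have [||r hr] := IH (k - d)%N _ (h' - 2 ^+ (k - d) * h); first by lia.
  rewrite -/(D k0) mulrBr hk mulrCA (mulrC (D k0)) -hd /D e; ring.
exists r.+1; rewrite exprSr -hr /V affM// subnK//; congr (aff _ _ _ _); ring.
Qed.

(** Eliminating [c] between the equations of two terms shows that [2 ^ N] divides a number
    independent of [N] and [c]. For large [N] this number is 0, so the compressed maps share their
    fixed point. *)
Lemma common_root_terms (l : seq aff_index) : exists N0, forall N c, (N0 <= N)%N ->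
  exists h d, (0 < d)%N /\ forall t, t \in l -> forall h',
    2 ^+ N * h' = (2 ^+ dilation t - 1) * c - offset t ->
    exists r, V h' (dilation t) = V h d ^+ r.
Proof.
pose D t : int := 2 ^+ dilation t - 1.
pose g t u := absz (D t * offset u - D u * offset t)%R.
pose N1 := \max_(t <- l) \max_(u <- l) g t u.
pose N2 := \max_(t <- l) `|offset t|%N.
exists (maxn N1 N2) => N c; rewrite geq_max => /andP[hN1 hN2].
(* As [N < 2 ^ N], a multiple of [2 ^ N] of absolute value at most [N] is zero. *)
have pow0 (z h : int) : 2 ^+ N * h = z -> (`|z| <= N)%N -> h = 0.
  move=> hz zN; apply/eqP/negPn/negP => h0.
  have : (2 ^ N <= `|z|)%N.
    by rewrite -hz abszM abszX leq_pmulr// absz_gt0.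
  by have := ltn_expl N (isT : (1 < 2)%N); lia.
have small t : t \in l -> (`|offset t| <= N)%N.
  by move=> tl; apply: leq_trans hN2; exact: (leq_bigmax_seq (F := fun t => `|offset t|%N)).
have gsmall t u : t \in l -> u \in l -> (g t u <= N)%N.
  move=> tl ul; apply: leq_trans hN1.
  apply: leq_trans (leq_bigmax_seq (F := fun t => \max_(u <- l) g t u) _ tl isT).
  exact: (leq_bigmax_seq (F := g t)).
have [[t0 [h0 [t0l [k0 e0]]]]|none] := pselect (exists t h, t \in l /\
    (0 < dilation t)%N /\ 2 ^+ N * h = D t * c - offset t).
  have [h [d [d0 H]]] := aff_common_root h0 k0.
  exists h, d; split=> // t tl h' e; apply: H; apply/eqP; rewrite -subr_eq0; apply/eqP.
  rewrite -/(D t0) -/(D t); apply: (pow0 (D t * offset t0 - D t0 * offset t)).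
    rewrite mulrBr mulrCA e (mulrCA _ (D t)) e0 -/(D t); ring.
  exact: gsmall.
(* No surviving term has positive dilation, so each one is [1] and any root serves, with exponent
   0. *)
exists 0, 1%N; split=> // t tl h' e; exists 0%N.
have [k0|k0] := posnP (dilation t); last by case: none; exists t, h'.
have -> : h' = 0.
  apply: (pow0 _ _ e); rewrite k0 expr0 subrr mul0r add0r abszN; exact: small.
by rewrite k0 expr0 /V aff00.
Qed.

Lemma commutant_conj x a m :
  (forall w, x * cuntz_proj S U w = cuntz_proj S U w * x) ->
  forall w, star (V a m) * x * V a m * cuntz_proj S U w =
            cuntz_proj S U w * (star (V a m) * x * V a m).
Proof.
move=> xP w; have [w' e] := conj_proj_aff rel a m w.
have : isometry_elt (V a m) by exact: aff_iso.
move: e (xP w'); rewrite -/V.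
move: (cuntz_proj S U w) (cuntz_proj S U w') (V a m) => p q v e xq i.
have e1 : v * p = q * v by rewrite -e -[RHS]mulrA i mulr1.
have e2 : star v * q = p * star v by rewrite -e !mulrA i mul1r.
by rewrite -mulrA e1 !mulrA -e2 -[_ * x * _]mulrA xq !mulrA.
Qed.

Hypothesis gen : cstar_gen [set S; U] = setT.

Lemma commutant_locally_scalar x (e : R) :
  (forall w, x * cuntz_proj S U w = cuntz_proj S U w * x) -> 0 < e ->
  exists N, forall w, size w = N -> exists c : R[i],
    cnorm (star (cuntz_word S U w) * x * cuntz_word S U w - c%:A) <= e.
Proof.
(* The tolerance [e / 3] absorbs the factor 3 of [toeplitz_rigidity]. *)
move=> xP e0; have e3 : 0 < e / 3 by rewrite divr_gt0.
have [y [l _ ly] xy] := aff_span_dense rel gen x e3.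
have [N0 hN0] := common_root_terms [seq t.2 | t <- l].
pose N3 := \max_(t <- l) maxn t.2.1.2 t.2.2.2.
exists (maxn N0 N3) => w sw; have [c wc] := word_aff rel w.
rewrite wc sw; set N := maxn _ _; rewrite -/(V c N).
have [h [d [d0 H]]] := hN0 N c (leq_maxl _ _).
set s := V h d; pose T := V (h + 1) d.
have s_iso : isometry_elt s by exact: aff_iso.
have T_iso : isometry_elt T by exact: aff_iso.
(* The ranges are the classes of [h + 1] and [h] modulo [2 ^ d]; nesting would force
   [2 ^ d * f = -1], impossible for [d > 0]. *)
have Ts0 : star T * s = 0.
  have [//|[f hf _]] := aff_adj_mul rel (h + 1) h (leqnn d).
  have : (2 %| 2 ^+ d * f)%Z by rewrite -(prednK d0) exprS -mulrA dvdz_mulr.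
  have -> : 2 ^+ d * f = -1 by lia.
  by [].
have term_symbol t : t \in l ->
    exists a, toeplitz_symbol s T (star (V c N) * aff_term S U t.2 * V c N) a.
  move=> tl; have tN : (maxn t.2.1.2 t.2.2.2 <= N)%N.
    apply: leq_trans (leq_maxr N0 N3).
    exact: (leq_bigmax_seq (F := fun t : R[i] * aff_index => maxn t.2.1.2 t.2.2.2)).
  move: tN; rewrite geq_max => /andP[t1 t2].
  have [->|[h' [eh X]]] := aff_term_conj c t1 t2.
    by exists 0; exact: toeplitz_symbol0.
  have [|r hr] := H t.2 _ h' eh; first exact: map_f.
  have sr := toeplitz_symbolX s_iso T_iso Ts0 r; rewrite -hr in sr.
  by case: X => ->; [exists (r == 0)%:R|exists (conjc (r == 0)%:R)];
    [|exact: toeplitz_symbol_star].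
have [a ya] : exists a, toeplitz_symbol s T (star (V c N) * y * V c N) a.
  rewrite -ly /aff_comb mulr_sumr mulr_suml.
  elim: (l) term_symbol => [|t l' IH] ts.
    by exists 0; rewrite big_nil; exact: toeplitz_symbol0.
  have [|a ha] := IH; first by move=> u ul; apply: ts; rewrite inE ul orbT.
  have [|b hb] := ts t; first by rewrite inE eqxx.
  exists (t.1 * b + a); rewrite big_cons; apply: toeplitz_symbolD => //.
  by rewrite -scalerAr -scalerAl; apply: toeplitz_symbolZ.
exists a; rewrite -(divfK (_ : 3 != 0 :> R) e)// mulrC.
apply: (toeplitz_rigidity s_iso T_iso Ts0 _ ya).
  (* [s ^ j * T] is again a monomial, so its range projection is a [cuntz_proj] and commutes with
     the compressed [x]. *)
  move=> j; have [b [n e']] := affX h d j.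
  have [w' ew] := aff_proj rel (b + 2 ^+ n * (h + 1)) (n + d).
  rewrite /s e' /T /V affM// ew; exact: commutant_conj.
rewrite -mulrBl -mulrBr; have n1 := cnorm_isometry (aff_iso rel c N).
rewrite -[e / 3]mulr1; apply: cnormM_le; last by rewrite n1.
by rewrite -[e / 3]mul1r; apply: cnormM_le; rewrite ?cnorm_star ?n1.
Qed.

End LocalScalars.

(** * The diagonal is maximal abelian *)

Section DiagonalMasa.
Variables (R : realType) (A : cstarType R) (S U : A).
Hypothesis rel : Q2_relations S U.
Hypothesis gen : cstar_gen [set S; U] = setT.

Lemma D2_proj w : D2 S U (cuntz_proj S U w).
Proof. by apply: sub_cstar_gen; exists w. Qed.

Lemma D2_one : D2 S U 1.
Proof. by have := D2_proj [::]; rewrite /cuntz_proj /cuntz_word big_nil star1 mulr1. Qed.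

Lemma cuntz_gen_iso i : isometry_elt (cuntz_gen S U i).
Proof. by have := cuntz_word_iso rel [:: i]; rewrite /cuntz_word big_seq1. Qed.

Lemma conj_subalgebra (s : A) (D : set A) : isometry_elt s ->
  cstar_subalgebra D -> cstar_subalgebra [set x | D (s * x * star s)].
Proof.
move=> s_iso [Dc [D0 DD] DZ DM Ds]; have n1 := cnorm_isometry s_iso; split.
- apply: (@cnorm_closed_preimage R A A (fun x => s * x * star s)) => // x y.
  rewrite -mulrBl -mulrBr -[X in _ <= X]mulr1.
  by apply: cnormM_le; rewrite ?cnorm_star ?n1// -[X in _ <= X]mul1r cnormM_le ?n1.
- by split=> [|x y hx hy] /=; rewrite ?mulr0 ?mul0r// mulrDr mulrDl; exact: DD.
- by move=> a x hx /=; rewrite -scalerAr -scalerAl; exact: DZ.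
- move=> x y hx hy /=; rewrite (_ : _ * _ = (s * x * star s) * (s * y * star s)).
    exact: DM.
  by rewrite !mulrA -[_ * star s * s]mulrA s_iso mulr1.
- by move=> x hx /=; have := Ds _ hx; rewrite !starM starK mulrA.
Qed.

Lemma D2_conj_aff a m d : D2 S U d ->
  D2 S U (aff S U a m * d * star (aff S U a m)).
Proof.
move=> hd; apply: (hd [set d | D2 S U (aff S U a m * d * star (aff S U a m))]).
  by apply: conj_subalgebra; [exact: aff_iso|exact: cstar_gen_subalgebra].
by move=> _ [w _ <-] /=; have [w' ->] := conj_proj_aff rel a m w; exact: D2_proj.
Qed.

Lemma cuntz_gen_aff i : cuntz_gen S U i = aff S U (i : nat)%:Z 1.
Proof. by case: i; rewrite ?aff_US ?aff_S. Qed.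

(** Approximants of the two compressions of [x] are glued along orthogonal ranges. The error of the
    sum is then a maximum, so the same [e] survives all [N] levels. *)
Lemma D2_approx_of_local N x (e : R) :
  (forall w, size w = N -> exists c : R[i],
    cnorm (star (cuntz_word S U w) * x * cuntz_word S U w - c%:A) <= e) ->
  (forall w, x * cuntz_proj S U w = cuntz_proj S U w * x) ->
  exists2 d, D2 S U d & cnorm (x - d) <= e.
Proof.
elim: N x => [|N IH] x hx xP.
  have [c] := hx [::] erefl; rewrite /cuntz_word big_nil star1 mul1r mulr1 => hc.
  exists c%:A => //; have [_ _ h _ _] := cstar_gen_subalgebra (range (cuntz_proj S U)).
  by apply: h; exact: D2_one.
have step i : exists2 d, D2 S U d &
    cnorm (star (cuntz_gen S U i) * x * cuntz_gen S U i - d) <= e.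
  apply: IH => [w sw|w].
    have [|c hc] := hx (i :: w); first by rewrite /= sw.
    exists c; move: hc; rewrite /cuntz_word big_cons starM; congr (cnorm (_ - _) <= _).
    by rewrite !mulrA.
  by rewrite cuntz_gen_aff; exact: commutant_conj.
have [d1 D1 h1] := step true; have [d2 D2' h2] := step false.
pose s1 := cuntz_gen S U true; pose s2 := cuntz_gen S U false.
have sum1 : s2 * star s2 + s1 * star s1 = 1 by exact: range_sum.
exists (s1 * d1 * star s1 + s2 * d2 * star s2).
  have [_ [_ hD] _ _ _] := cstar_gen_subalgebra (range (cuntz_proj S U)).
  by apply: hD; rewrite /s1 /s2 cuntz_gen_aff; exact: D2_conj_aff.
have comm i : x * (cuntz_gen S U i * star (cuntz_gen S U i)) =
    cuntz_gen S U i * star (cuntz_gen S U i) * x.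
  by have := xP [:: i]; rewrite /cuntz_proj /cuntz_word big_seq1.
have dec i : cuntz_gen S U i * (star (cuntz_gen S U i) * x * cuntz_gen S U i) *
    star (cuntz_gen S U i) = cuntz_gen S U i * star (cuntz_gen S U i) * x.
  have is_ := cuntz_gen_iso i; move: (cuntz_gen S U i) is_ (comm i) => s is_ c.
  by rewrite !mulrA -c -!mulrA (mulrA (star s)) is_ mul1r.
have -> : x - (s1 * d1 * star s1 + s2 * d2 * star s2) =
   s1 * (star s1 * x * s1 - d1) * star s1 + s2 * (star s2 * x * s2 - d2) * star s2.
  rewrite !mulrBr !mulrBl /s1 /s2 !dec addrACA -opprD; congr (_ - _).
  by rewrite -mulrDl addrC [X in X * _]sum1 mul1r.
apply: cnorm_orthogonal_sum => //; [exact: cuntz_gen_iso|exact: cuntz_gen_iso|].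
exact: (sUSS rel).
Qed.

Lemma D2_maximal_abelian x :
  (forall w, x * cuntz_proj S U w = cuntz_proj S U w * x) -> D2 S U x.
Proof.
move=> xP; have [+ _ _ _ _] := cstar_gen_subalgebra (range (cuntz_proj S U)).
move/cnorm_closed_approx; apply => e e0.
have [N hN] := commutant_locally_scalar rel gen xP e0.
exact: D2_approx_of_local hN xP.
Qed.

Lemma D2_comm x y : D2 S U x -> D2 S U y -> x * y = y * x.
Proof.
apply: commute_comm => [_ [w _ <-]|_ _ [v _ <-] [w _ <-]].
  exact: cuntz_proj_star.
exact: cuntz_proj_comm.
Qed.

Lemma D2_sub_O2 : D2 S U `<=` O2 S U.
Proof.
move=> x; apply; first exact: cstar_gen_subalgebra.
have [_ _ _ OM Os] := cstar_gen_subalgebra (range (cuntz_gen S U)).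
move=> _ [w _ <-].
have Og i : O2 S U (cuntz_gen S U i) by apply: sub_cstar_gen; exists i.
have O1 : O2 S U 1.
  by rewrite -(cuntz_gen_iso true); apply: OM; [apply: Os|]; exact: Og.
have Ow : O2 S U (cuntz_word S U w).
  elim: w => [|i w IH]; first by rewrite /cuntz_word big_nil.
  by rewrite /cuntz_word big_cons; apply: OM => //; exact: Og.
by apply: OM => //; exact: Os.
Qed.

(** * Automorphisms that fix the diagonal *)

Lemma Aut_fixing_aff f a m : Aut_fixing (D2 S U) f ->
  exists2 d, D2 S U d & f (aff S U a m) = aff S U a m * d.
Proof.
move=> [[[_ _ fM _ fs] _] fD]; set v := aff S U a m.
have v_iso : isometry_elt v by exact: aff_iso.
have fP w : f (v * cuntz_proj S U w * star v) = v * cuntz_proj S U w * star v.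
  by have [w' ->] := conj_proj_aff rel a m w; apply: fD; exact: D2_proj.
move: v v_iso fP => v v_iso fP.
(* Apply [f] to [v * p = (v * p * star v) * v], where both [p] and [v * p * star v] are fixed. *)
have fv w : f v * cuntz_proj S U w = v * cuntz_proj S U w * star v * f v.
  rewrite -fP -{1}(fD _ (D2_proj w)) -!fM//; congr f.
  by rewrite -mulrA v_iso mulr1.
exists (star v * f v).
  apply: D2_maximal_abelian => w; rewrite -mulrA fv.
  by move: (cuntz_proj S U w) (f v) => p y; rewrite !mulrA v_iso mul1r.
(* The empty word has projection [1] and gives [f v = v * star v * f v]. *)
have := fv [::]; rewrite /cuntz_proj /cuntz_word big_nil star1 !mulr1 => e.
by rewrite mulrA -e.
Qed.

Lemma Aut_fixing_inv f : Aut_fixing (D2 S U) f ->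
  exists g, [/\ Aut_fixing (D2 S U) g, cancel f g & cancel g f].
Proof.
move=> [/star_aut_inv[g [hg fg gf]] fD]; exists g; split=> //.
by split=> // x Dx; rewrite -{1}(fD x Dx) fg.
Qed.

Lemma Aut_fixing_O2 f x : Aut_fixing (D2 S U) f -> O2 S U x -> O2 S U (f x).
Proof.
move=> hf hx; have [[hom _] _] := hf; apply: (hx (f @^-1` O2 S U)).
  by apply: cstar_subalgebra_preimage => //; exact: cstar_gen_subalgebra.
have [_ _ _ OM _] := cstar_gen_subalgebra (range (cuntz_gen S U)).
move=> _ [i _ <-]; rewrite /preimage /= cuntz_gen_aff.
have [d hd ->] := Aut_fixing_aff i%:Z 1 hf.
by rewrite -cuntz_gen_aff; apply: OM; [apply: sub_cstar_gen; exists i|exact: D2_sub_O2].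
Qed.

(** Surjectivity onto [O2] comes from the inverse, which also fixes [D2] and so preserves [O2]. *)
Lemma Aut_fixing_O2_aut f : Aut_fixing (D2 S U) f -> star_aut_on (O2 S U) f.
Proof.
move=> hf; have [g [hg fg gf]] := Aut_fixing_inv hf.
have [[[fD fZ fM f1 fs] _] _] := hf.
split; first by split=> *; rewrite ?fD ?fZ ?fM ?f1 ?fs.
split=> [x|x y _ _ h|y hy]; first exact: Aut_fixing_O2.
- by rewrite -(fg x) h fg.
- by exists (g y) => //; exact: Aut_fixing_O2.
Qed.

Lemma star_hom_eq f g : star_hom_on setT f -> star_hom_on setT g ->
  f S = g S -> f U = g U -> f = g :> (A -> A).
Proof.
move=> hf hg eS eU; apply/funext => x.
have hx : cstar_gen [set S; U] x by rewrite gen.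
by apply: star_hom_gen_eq hx => // y [->|->].
Qed.

(* An automorphism fixing [O2] sends [U] to [U * d] with [d] in [D2]; then
   [v = d - 1] satisfies [v * S = 0] and commutes with [U * S], so it is
   compressed to itself by the words [(U * S) ^ N], at which it is almost scalar. *)
Lemma fixing_O2_eq_id f : star_aut_on setT f ->
  (forall x, O2 S U x -> f x = x) -> f = id.
Proof.
move=> aut fO; have [hom _] := aut; have [fD fZ fM f1 fs] := hom.
have hf : Aut_fixing (D2 S U) f by split=> // x /D2_sub_O2; exact: fO.
have fS : f S = S by apply: fO; apply: sub_cstar_gen; exists false.
apply: star_hom_eq => //.
have [d Dd] := Aut_fixing_aff 1 0 hf.
have -> : aff S U 1 0 = U by rewrite /aff expr0 mulr1.
move=> fU.
have fUS : f (U * S) = U * S by apply: fO; apply: sub_cstar_gen; exists true.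
have [_ [sUU UsU] _ SU] := rel.
have Ucancel (x y : A) : U * x = U * y -> x = y.
  by move=> e; rewrite -[x]mul1r -sUU -mulrA e mulrA sUU mul1r.
have dS : d * S = S by apply: Ucancel; rewrite mulrA -fU -fUS fM// fS.
(* Applying [f] to [S * U = U ^ 2 * S] gives [U ^ 2 * S * d = U * d * U * S], since [d * S = S]
   absorbs the last [d]. *)
have dUS : U * S * d = d * (U * S).
  have e : f (S * U) = f (U ^+ 2 * S) by rewrite SU.
  rewrite expr2 !fM// fS fU in e.
  apply: Ucancel; rewrite !mulrA -expr2 -SU -mulrA e -!mulrA; congr (U * _).
  by rewrite dS.
pose v := d - 1; suff v0 : v = 0.
  by rewrite fU -[d](subrK 1) -/v v0 add0r mulr1.
have vS : v * S = 0 by rewrite mulrBl dS mul1r subrr.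
have vUS : v * (U * S) = U * S * v by rewrite mulrBl mulrBr dUS mul1r mulr1.
have vP w : v * cuntz_proj S U w = cuntz_proj S U w * v.
  by rewrite mulrBl mulrBr (D2_comm Dd (D2_proj w)) mul1r mulr1.
apply: cnorm_le0 => e e0; have e20 : 0 < e / 2 by rewrite divr_gt0.
have [N hN] := commutant_locally_scalar rel gen vP e20.
have [c hc] := hN _ (size_nseq N true).
have vw : star (cuntz_word S U (nseq N true)) * v * cuntz_word S U (nseq N true) = v.
  have -> : cuntz_word S U (nseq N true) = (U * S) ^+ N.
    by rewrite /cuntz_word big_nseq; elim: N {hN hc} => //= N ->; rewrite exprS.
  have vX : v * (U * S) ^+ N = (U * S) ^+ N * v by exact: commrX.
  by rewrite -mulrA vX mulrA (isometryX N (cuntz_gen_iso true)) mul1r.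
rewrite vw in hc.
(* Compressing [v - c%:A] by [S] kills [v] and leaves [- c%:A], so the scalar is as small as the
   error. *)
have cS : cnorm (c%:A : A) <= e / 2.
  have S_n1 := cnorm_isometry (S_iso rel).
  have -> : cnorm (c%:A : A) = cnorm (star S * (v - c%:A) * S).
    rewrite mulrBr mulrBl -mulrA vS mulr0 sub0r cnormN -scalerAr -scalerAl mulr1.
    by rewrite (S_iso rel).
  rewrite -[e / 2]mulr1; apply: cnormM_le; last by rewrite S_n1.
  by rewrite -[e / 2]mul1r; apply: cnormM_le; rewrite ?cnorm_star ?S_n1.
by have := cnormD (v - c%:A) c%:A; rewrite subrK; lra.
Qed.

End DiagonalMasa.

Theorem corollary3p3 (R : realType) (Q2 : cstarType R) (S2 U : Q2)
    (hQ2 : is_Q2 S2 U) :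
  (forall alpha : Q2 -> Q2, Aut_fixing (D2 S2 U) alpha ->
     [/\ star_aut_on (O2 S2 U) alpha,
         forall x, D2 S2 U x -> O2 S2 U x /\ alpha x = x &
         forall beta : Q2 -> Q2, star_aut_on setT beta ->
           (forall x, O2 S2 U x -> beta x = alpha x) -> beta = alpha])
  /\ (forall alpha beta : Q2 -> Q2,
        Aut_fixing (D2 S2 U) alpha -> Aut_fixing (D2 S2 U) beta ->
        alpha \o beta = beta \o alpha).
Proof.
have [rel gen _] := hQ2; split=> [alpha ha|alpha beta ha hb].
  have [aut aD] := ha; split; first exact: Aut_fixing_O2_aut.
    by move=> x Dx; split; [exact: D2_sub_O2|exact: aD].
  move=> beta hb ab; have [g [[gaut _] ag ga]] := Aut_fixing_inv ha.
  (* On [O2], [beta] agrees with [alpha], which [g] undoes. *)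
  have gb : g \o beta = id.
    apply: (fixing_O2_eq_id rel gen); first exact: star_aut_comp.
    by move=> x Ox /=; rewrite ab// ag.
  by apply/funext => x; rewrite -[LHS]ga; congr alpha; exact: (congr1 (@^~ x) gb).
have [[homa _] aD] := ha; have [[homb _] bD] := hb.
have [_ _ aM _ _] := homa; have [_ _ bM _ _] := homb.
(* [alpha] fixes [d'] and [beta] fixes [d], so the two sides differ only in the order of [d] and
   [d'], which commute. *)
have comm a m : alpha (beta (aff S2 U a m)) = beta (alpha (aff S2 U a m)).
  have [d Dd ed] := Aut_fixing_aff rel gen a m ha.
  have [d' Dd' ed'] := Aut_fixing_aff rel gen a m hb.
  rewrite ed ed' aM// bM// (aD _ Dd') (bD _ Dd) ed ed'.
  by rewrite -!(mulrA (aff _ _ _ _)) (D2_comm rel Dd Dd').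
apply: (star_hom_eq gen); [exact: star_hom_comp|exact: star_hom_comp| |] => /=.
  by have := comm 0 1%N; rewrite aff_S.
by have := comm 1 0%N; rewrite /aff expr0 mulr1.
Qed.
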